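(* Assume $u_0(\boldsymbol{x})\ge 0$ and $g(\boldsymbol{x},t)\ge 0$ for all $\boldsymbol{x}$ and $t$. Let $(\boldsymbol{u}^n)_{n\ge 0}$ be generated by the explicit-reaction scheme $$(M+\Delta t_n A)\,\boldsymbol{u}^{n+1} = (M+\Delta t_n\, C(\boldsymbol{u}^n))\,\boldsymbol{u}^{n}+\Delta t_n\,\boldsymbol{g}^{n+1},\qquad n=0,1,\ldots,$$ where $C(\boldsymbol{u}^n)=(c_{ij})$ is the $N_v\times N_v$ matrix with $c_{ij}=\int_\Omega f(u_h^n)\,\phi_j\phi_i\,d\boldsymbol{x}$ for $i=1,\ldots,N_{vi}$ and $c_{ij}=0$ for $i=N_{vi}+1,\ldots,N_v$ ($j=1,\ldots,N_v$). Suppose that the mesh satisfies the anisotropic nonobtuse angle condition, i.e. $\mathbb{D}_{acute}\ge 0$, and that the time step satisfies $$\frac{\left(\frac{|\Omega|}{N_e}\right)^{2/d}}{(d+1)(d+2)\,\mathbb{D}_{acute}}\ \le\ \Delta t_n\ \le\ \frac{1}{\max_{\boldsymbol{x}}|f^{-}(u_h^n)|},\qquad n=0,1,\ldots$$ Then the scheme preserves nonnegativity: $u_j^n\ge 0$ for all $j=1,\ldots,N_v$ and all $n\ge 0$ (equivalently, $u_h^n\ge 0$ on $\Omega$ for all $n\ge 0$).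
   Context: Continuous problem: $\partial_t u-\nabla\cdot(\mathbb{D}\nabla u)=u f(u)$ in $\Omega\times(0,T]$, $u=g$ on $\partial\Omega\times(0,T]$, $u(\cdot,0)=u_0$ in $\Omega$. Here $d\in\{1,2,3\}$, $\Omega\subset\mathbb{R}^d$ is a connected bounded polygonal or polyhedral domain, $T>0$; the diffusion tensor $\mathbb{D}=\mathbb{D}(\boldsymbol{x})$ is a $d\times d$ matrix function that is continuous (and integrable over $\Omega$), symmetric and uniformly positive definite on $\Omega$; $f:\mathbb{R}\to\mathbb{R}$ is such that $f$ and $f'$ exist, are continuous, and are bounded for all bounded $u$; $u_0$ and $g$ are given functions (with $u_0$ defined at all mesh vertices). Mesh: $\mathcal{T}_h$ is a (conforming) simplicial triangulation of $\Omega$ with $N_e$ elements, $N_v$ vertices $\boldsymbol{x}_1,\ldots,\boldsymbol{x}_{N_v}$, of which the first $N_{vi}$ are the interior vertices (not on $\partial\Omega$). $\phi_j$ is the continuous piecewise linear basis function with $\phi_j(\boldsymbol{x}_i)=\delta_{ij}$. $|K|$ and $|\Omega|$ denote volumes; $\mathbb{D}_K$ is the average of $\mathbb{D}$ over $K\in\mathcal{T}_h$. Matrices: $M=(m_{ij})$ with $m_{ij}=\int_\Omega\phi_j\phi_i\,d\boldsymbol{x}$ for $i\le N_{vi}$ and $m_{ij}=0$ for $i>N_{vi}$; $A=(a_{ij})$ with $a_{ij}=\int_\Omega(\nabla\phi_i)^T\mathbb{D}\nabla\phi_j\,d\boldsymbol{x}=\sum_{K\in\mathcal{T}_h}|K|(\nabla\phi_i)^T\mathbb{D}_K\nabla\phi_j$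 (gradients taken on $K$) for $i\le N_{vi}$ and $a_{ij}=\delta_{ij}$ for $i>N_{vi}$ ($j=1,\ldots,N_v$). Time levels: $0=t_0<t_1<\cdots$ in $[0,T]$, $\Delta t_n=t_{n+1}-t_n$. The vector $\boldsymbol{u}^n=(u_1^n,\ldots,u_{N_v}^n)^T$ contains the nodal values of $u_h^n=\sum_{j=1}^{N_v}u_j^n\phi_j$, with initial vector $u_j^0=u_0(\boldsymbol{x}_j)$. $\boldsymbol{g}^{n+1}$ has entries $0$ for $i\le N_{vi}$ and $g(\boldsymbol{x}_i,t_{n+1})$ for $i>N_{vi}$. Mesh quantity: for each $K\in\mathcal{T}_h$ let $\phi_0,\ldots,\phi_d$ denote (local numbering) the linear basis functions on $K$ of its $d+1$ vertices, and set $$\mathbb{D}_{acute}=\left(\frac{|\Omega|}{N_e}\right)^{2/d}\min_{K\in\mathcal{T}_h}\ \min_{i,j=0,\ldots,d,\ i\ne j}\left(-(\nabla\phi_i)^T\mathbb{D}_K\nabla\phi_j\right).$$ The anisotropic nonobtuse angle condition is: $(\nabla\phi_i)^T\mathbb{D}_K\nabla\phi_j\le 0$ for all $i\ne j$ and all $K$, i.e. $\mathbb{D}_{acute}\ge 0$. Notation: $v^+=\max\{v,0\}$, $v^-=\min\{v,0\}$, and $\max_{\boldsymbol{x}}$ is the maximum over $\overline{\Omega}$. A fraction with positive numerator and zero denominator is read as $+\infty$ (so the lower bound on $\Delta t_n$ cannot be met if $\mathbb{D}_{acute}=0$, and there is no upper bound if the maximum is $0$). *)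

(* Defs.v *)
From HB Require Import structures.
From mathcomp Require Import all_boot all_order all_algebra.
From mathcomp Require Import all_classical all_reals all_analysis.

Set Implicit Arguments.
Unset Strict Implicit.
Unset Printing Implicit Defensive.

Import Order.TTheory GRing.Theory Num.Theory.
Import numFieldNormedType.Exports.

Local Open Scope classical_set_scope.
Local Open Scope ring_scope.

(* The sigma-algebra on row vectors is the one generated by the coordinates;
   it is the Borel sigma-algebra of R^n. *)
Definition rV_display : measure_display. Proof. exact: default_measure_display. Qed.

Section measurable_rV.
Variables (R : realType) (n : nat).

Definition rV_coord (i : 'I_n) (x : 'rV[R]_n) : measurableTypeR R := x ord0 i.

Let rV_set0 : g_sigma_preimage rV_coord set0.
Proof. exact: sigma_algebra0. Qed.

Let rV_setC A : g_sigma_preimage rV_coord A -> g_sigma_preimage rV_coord (~` A).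
Proof. exact: sigma_algebraC. Qed.

Let rV_bigcup (F : (set 'rV[R]_n)^nat) :
  (forall i, g_sigma_preimage rV_coord (F i)) ->
  g_sigma_preimage rV_coord (\bigcup_i (F i)).
Proof. exact: sigma_algebra_bigcup. Qed.

HB.instance Definition _ := @isMeasurable.Build rV_display
  'rV[R]_n (g_sigma_preimage rV_coord) rV_set0 rV_setC rV_bigcup.

Lemma measurable_rV_coord (i : 'I_n) : measurable_fun [set: 'rV[R]_n] (rV_coord i).
Proof.
move=> _ Y mY; rewrite setTI; apply: sub_sigma_algebra => /=.
rewrite -bigcup_seq/=; exists i => /=; first by rewrite mem_index_enum.
by exists Y => //; rewrite setTI.
Qed.

Lemma measurable_rV_fun d (T : measurableType d) (f : T -> 'rV[R]_n) :
  (forall i, measurable_fun [set: T] (rV_coord i \o f)) ->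
  measurable_fun [set: T] f.
Proof.
move=> mf _ A mA.
suff : [set A | @measurable _ T (f @^-1` A)] A by rewrite setTI.
apply: mA; split=> /=.
  split => /=.
  - by rewrite preimage_set0; exact: measurable0.
  - by move=> B /= mB; rewrite setTD -preimage_setC; exact: measurableC.
  - by move=> F mF; rewrite /= preimage_bigcup; exact: bigcup_measurable.
rewrite -bigcup_seq => B/= [i _ [C mC <-]] /=.
by rewrite setTI -[_ @^-1` _]setTI -comp_preimage; exact: mf.
Qed.

End measurable_rV.

(* n-dimensional Lebesgue measure, built as the n-fold product of the
   Lebesgue measure of the real line. *)
Section lebesgue_rV.
Variable R : realType.

Definition rV_cons n (p : measurableTypeR R * 'rV[R]_n) : 'rV[R]_n.+1 :=
  row_mx (p.1)%:M p.2.

Lemma rV_coord0_cons n p : rV_coord ord0 (@rV_cons n p) = p.1.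
Proof.
rewrite /rV_coord (_ : @ord0 n = lshift n (@ord0 0)); last exact: val_inj.
by rewrite [LHS](@row_mxEl _ 1 1 n) mxE eqxx mulr1n.
Qed.

Lemma rV_coordS_cons n p (i : 'I_n) :
  rV_coord (lift ord0 i) (@rV_cons n p) = rV_coord i p.2.
Proof.
rewrite /rV_coord (_ : lift ord0 i = rshift 1 i); last exact: val_inj.
exact: (@row_mxEr _ 1 1 n).
Qed.

Lemma measurable_rV_cons n :
  measurable_fun [set: measurableTypeR R * 'rV[R]_n] (@rV_cons n).
Proof.
apply: measurable_rV_fun => i; case: (unliftP ord0 i) => [j|] ->.
  rewrite (_ : _ \o _ = rV_coord j \o snd); last first.
    by apply/funext => p /=; rewrite rV_coordS_cons.
  exact: measurableT_comp (measurable_rV_coord j) measurable_snd.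
rewrite (_ : _ \o _ = fst); first exact: measurable_fst.
by apply/funext => p /=; rewrite rV_coord0_cons.
Qed.

Section step.
Variables (n : nat) (mu : {sigma_finite_measure set 'rV[R]_n -> \bar R}).

Definition lebesgue_rV_step : set 'rV[R]_n.+1 -> \bar R :=
  pushforward (lebesgue_measure \x mu)%E (@rV_cons n).

Let step0 : lebesgue_rV_step set0 = 0%E.
Proof. by rewrite /lebesgue_rV_step /pushforward preimage_set0 measure0. Qed.

Let step_ge0 A : (0 <= lebesgue_rV_step A)%E.
Proof. by rewrite /lebesgue_rV_step /pushforward; exact: measure_ge0. Qed.

Let step_sigma_additive : semi_sigma_additive lebesgue_rV_step.
Proof.
move=> F mF tF mUF; rewrite /lebesgue_rV_step /pushforward preimage_bigcup.
apply: measure_semi_sigma_additive.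
- by move=> k; rewrite -[X in measurable X]setTI; exact: measurable_rV_cons.
- apply/trivIsetP => /= i j _ _ ij; rewrite -preimage_setI.
  by move/trivIsetP : tF => /(_ _ _ _ _ ij) ->//; rewrite preimage_set0.
- rewrite -preimage_bigcup -[X in measurable X]setTI.
  exact: measurable_rV_cons.
Qed.

HB.instance Definition _ := isMeasure.Build _ _ _ lebesgue_rV_step
  step0 step_ge0 step_sigma_additive.

Let rV_uncons (x : 'rV[R]_n.+1) : measurableTypeR R * 'rV[R]_n :=
  (rV_coord ord0 x, \row_i rV_coord (lift ord0 i) x).

Let measurable_uncons : measurable_fun [set: 'rV[R]_n.+1] rV_uncons.
Proof.
apply/measurable_fun_pairP; split; first exact: measurable_rV_coord.
apply: measurable_rV_fun => i.
rewrite (_ : _ \o _ = rV_coord (lift ord0 i)); first exact: measurable_rV_coord.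
by apply/funext => x /=; rewrite /rV_coord mxE.
Qed.

Let rV_consK p : rV_uncons (rV_cons p) = p.
Proof.
case: p => a x; rewrite /rV_uncons rV_coord0_cons; congr pair.
by apply/rowP => i; rewrite mxE rV_coordS_cons.
Qed.

Let step_sigma_finite : sigma_finite setT lebesgue_rV_step.
Proof.
have /sigma_finiteP[F [UF ndF mF]] := sigma_finiteT (@lebesgue_measure R).
have /sigma_finiteP[G [UG ndG mG]] := sigma_finiteT mu.
exists (fun k => rV_uncons @^-1` (F k `*` G k)).
  rewrite -preimage_bigcup (_ : \bigcup_k _ = setT) ?preimage_setT//.
  apply/seteqP; split=> // -[a x] _.
  have [i _ Fia] : (\bigcup_i F i) a by rewrite -UF.
  have [j _ Gjx] : (\bigcup_i G i) x by rewrite -UG.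
  exists (maxn i j) => //; split.
    by move: Fia; exact/subsetPset/ndF/leq_maxl.
  by move: Gjx; exact/subsetPset/ndG/leq_maxr.
move=> k; have [mFk Fk] := mF k; have [mGk Gk] := mG k; split.
  rewrite -[X in measurable X]setTI; apply: measurable_uncons => //.
  exact: measurableX.
rewrite /lebesgue_rV_step /pushforward -comp_preimage.
rewrite (_ : _ \o _ = id); last by apply/funext => p /=; exact: rV_consK.
rewrite preimage_id product_measure1E// lte_mul_pinfty//.
by rewrite ge0_fin_numE.
Qed.

HB.instance Definition _ := Measure_isSigmaFinite.Build _ _ _
  lebesgue_rV_step step_sigma_finite.

End step.

Fixpoint lebesgue_rV n : {sigma_finite_measure set 'rV[R]_n -> \bar R} :=
  match n with
  | 0 => \d_(0 : 'rV[R]_0)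
  | n'.+1 => lebesgue_rV_step (lebesgue_rV n')
  end.

Lemma lebesgue_rV_box n (a b : 'I_n -> R) : (forall i, a i <= b i) ->
  lebesgue_rV n [set x | forall i, a i <= x ord0 i <= b i] =
  (\prod_i (b i - a i))%:E.
Proof.
elim: n a b => [|n IHn] a b ab.
  rewrite big_ord0 /= diracE mem_set// => -[].
  by [].
rewrite /= /lebesgue_rV_step /pushforward.
rewrite (_ : _ @^-1` _ = `[a ord0, b ord0]%classic `*`
    [set x : 'rV[R]_n | forall i, a (lift ord0 i) <= x ord0 i <= b (lift ord0 i)]).
  rewrite product_measure1E//.
  - rewrite IHn// [X in (X * _)%E](lebesgue_measure_itv `[a ord0, b ord0])/=.
    rewrite big_ord_recl EFinM lte_fin; congr (_ * _)%E.
    by case: ltgtP (ab ord0) => // -> _; rewrite subrr.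
  - rewrite (_ : [set _ | _] = \bigcap_(i in [set: 'I_n])
      (rV_coord i @^-1` `[a (lift ord0 i), b (lift ord0 i)]%classic)).
      apply: fin_bigcap_measurable => //= i _.
      rewrite -[X in measurable X]setTI; exact: measurable_rV_coord.
    apply/seteqP; split=> x /= h i; first by move=> _; rewrite /= in_itv/=; exact: h.
    by have := h i I; rewrite /= in_itv.
apply/seteqP; split=> -[c x] /= h.
  split=> /=; first by have := h ord0; rewrite -/(rV_coord _ _) rV_coord0_cons in_itv.
  by move=> i; have := h (lift ord0 i); rewrite -/(rV_coord _ _) rV_coordS_cons.
case: h => hc hx i; case: (unliftP ord0 i) => [j|] ->.
  by rewrite -/(rV_coord _ _) rV_coordS_cons; exact: hx.
by rewrite -/(rV_coord _ _) rV_coord0_cons; rewrite in_itv in hc.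
Qed.

End lebesgue_rV.

Section geometry.
Variables (R : realType) (d : nat).

Definition boundary (A : set 'rV[R]_d) : set 'rV[R]_d := closure A `\` A°.

Definition affinely_independent (I : finType) (p : I -> 'rV[R]_d) (S : {set I}) :
    Prop :=
  forall a : I -> R, \sum_(i in S) a i = 0 -> \sum_(i in S) a i *: p i = 0 ->
    forall i, i \in S -> a i = 0.

Definition hull (I : finType) (p : I -> 'rV[R]_d) (S : {set I}) : set 'rV[R]_d :=
  [set y | exists a : I -> R, [/\ forall i, i \in S -> 0 <= a i,
    \sum_(i in S) a i = 1 & y = \sum_(i in S) a i *: p i]].

(* The boundary is made of finitely many (d-1)-simplices: points if d = 1,
   segments if d = 2, triangles if d = 3. *)
Record polyhedral_domain (Omega : set 'rV[R]_d) : Prop := PolyhedralDomain {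
  domain_open : open Omega;
  domain_nonempty : Omega !=set0;
  domain_connected : connected Omega;
  domain_bounded : bounded_set Omega;
  domain_polyhedral : exists (m : nat) (p : 'I_m -> 'I_d -> 'rV[R]_d),
    (forall k, affinely_independent (p k) [set: 'I_d]%SET) /\
    boundary Omega = \bigcup_(k in [set: 'I_m]) hull (p k) [set: 'I_d]%SET }.

Definition volume (A : set 'rV[R]_d) : R := fine (lebesgue_rV R d A).

Definition grad (F : 'rV[R]_d -> R) (y : 'rV[R]_d) : 'cV[R]_d :=
  \col_k 'D_(delta_mx ord0 k) F y.

Definition bform (B : 'M[R]_d) (u v : 'cV[R]_d) : R := (u^T *m B *m v) 0 0.

Record diffusion_tensor (Omega : set 'rV[R]_d) (D : 'rV[R]_d -> 'M[R]_d) : Prop :=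
  DiffusionTensor {
  tensor_continuous : {within Omega, continuous D};
  tensor_integrable : forall k l,
    (lebesgue_rV R d).-integrable Omega (fun y => (D y k l)%:E);
  tensor_symmetric : forall y, Omega y -> (D y)^T = D y;
  tensor_posdef : exists2 alpha : R, 0 < alpha &
    forall y, Omega y -> forall v : 'cV[R]_d,
      alpha * \sum_k v k 0 ^+ 2 <= bform (D y) v v }.

End geometry.

Section finite_elements.
Variables (R : realType) (d Nv : nat).
Variables (Omega : set 'rV[R]_d) (x : 'I_Nv -> 'rV[R]_d) (Th : {set {set 'I_Nv}}).

(* An element is given by the set of its vertex indices: K : {set 'I_Nv} stands
   for the closed simplex hull x K.  The number Nvi counts the interior
   vertices, which are numbered first.  The condition mesh_interior follows
   from mesh_cover when Omega is the interior of its closure; in general it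
   says that no element is cut by the boundary of Omega. *)
Record triangulation (Nvi : nat) : Prop := Triangulation {
  mesh_vertex_inj : injective x;
  mesh_simplex : forall K, K \in Th -> #|K| = d.+1 /\ affinely_independent x K;
  mesh_vertex : forall i, exists2 K, K \in Th & i \in K;
  mesh_cover : closure Omega = \bigcup_(K in [set K | K \in Th]) hull x K;
  mesh_interior : forall K, K \in Th -> (hull x K)° `<=` Omega;
  mesh_conforming : forall K K', K \in Th -> K' \in Th ->
    hull x K `&` hull x K' = hull x (K :&: K')%SET;
  mesh_Nvi : (Nvi <= Nv)%N;
  mesh_numbering : forall i : 'I_Nv, (i < Nvi)%N <-> ~ boundary Omega (x i) }.

(* These conditions determine phi on the closure of Omega. *)
Record P1_basis (phi : 'I_Nv -> 'rV[R]_d -> R) : Prop := P1Basis {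
  P1_continuous : forall j, {within closure Omega, continuous (phi j)};
  P1_linear : forall j K, K \in Th -> exists (b : 'cV[R]_d) (c : R),
    forall y, hull x K y -> phi j y = (y *m b) 0 0 + c;
  P1_nodal : forall i j, phi j (x i) = (i == j)%:R }.

Variables (phi : 'I_Nv -> 'rV[R]_d -> R) (D : 'rV[R]_d -> 'M[R]_d) (Nvi : nat).

Definition centroid (K : {set 'I_Nv}) : 'rV[R]_d :=
  #|K|%:R^-1 *: \sum_(i in K) x i.

(* The constant gradient of phi_i on K, read off at an interior point of K
   because phi_i need not be differentiable on the faces. *)
Definition elt_grad (K : {set 'I_Nv}) (i : 'I_Nv) : 'cV[R]_d :=
  grad (phi i) (centroid K).

(* Average of D over K; D is only meaningful on Omega, and K \ Omega is a
   null set. *)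
Definition elt_avg (K : {set 'I_Nv}) : 'M[R]_d :=
  (volume (hull x K))^-1 *:
  \matrix_(k, l) (\int[lebesgue_rV R d]_(y in hull x K `&` Omega) D y k l).

Definition mesh_scale : R := (volume Omega / #|Th|%:R) `^ (2 / d%:R).

(* The infimum of a finite nonempty set of reals is its minimum. *)
Definition D_acute : R := mesh_scale *
  inf [set q | exists K, [/\ K \in Th & exists i j,
    [/\ i \in K, j \in K, i != j &
        q = - bform (elt_avg K) (elt_grad K i) (elt_grad K j)]]].

Definition fe_fun (w : 'cV[R]_Nv) (y : 'rV[R]_d) : R := \sum_j w j 0 * phi j y.

Definition mass_mx : 'M[R]_Nv := \matrix_(i, j)
  if (i < Nvi)%N then \int[lebesgue_rV R d]_(y in Omega) (phi j y * phi i y)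
  else 0.

Definition stiffness_mx : 'M[R]_Nv := \matrix_(i, j)
  if (i < Nvi)%N then
    \int[lebesgue_rV R d]_(y in Omega)
      bform (D y) (grad (phi i) y) (grad (phi j) y)
  else (i == j)%:R.

Definition reaction_mx (f : R -> R) (w : 'cV[R]_Nv) : 'M[R]_Nv := \matrix_(i, j)
  if (i < Nvi)%N then
    \int[lebesgue_rV R d]_(y in Omega) (f (fe_fun w y) * phi j y * phi i y)
  else 0.

Definition boundary_vec (g : 'rV[R]_d -> R -> R) (s : R) : 'cV[R]_Nv :=
  \col_i if (i < Nvi)%N then 0 else g (x i) s.

(* max |f^-(u_h)| over the closure of Omega, attained when u_h and f are
   continuous. *)
Definition max_fneg (f : R -> R) (w : 'cV[R]_Nv) : R :=
  sup [set `|Num.min (f (fe_fun w y)) 0| | y in closure Omega].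

End finite_elements.

Record reaction_term (R : realType) (f : R -> R) : Prop := ReactionTerm {
  reaction_derivable : forall v, derivable f v 1;
  reaction_continuous : continuous f;
  reaction_derive_continuous : continuous (derive1 f);
  reaction_bounded : forall B, exists C,
    forall v, `|v| <= B -> `|f v| <= C /\ `|derive1 f v| <= C }.

(* a / b read as +oo when b = 0, for a positive numerator a. *)
Definition efrac (R : realType) (a b : R) : \bar R :=
  if b == 0 then +oo%E else (a / b)%:E.

(* Main.v *)
(** Off the diagonal, the entry of [M + dt A] is a sum over the elements [K]
    containing both vertices of [|K| (1/((d+1)(d+2)) + dt grad_i^T D_K grad_j)],
    which the lower bound on [dt] makes nonpositive; since the basis functions
    sum to 1, the row sums of [A] vanish and those of [M] are positive. So
    [M + dt A] satisfies a discrete minimum principle: at a negative minimum of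
    [u^(n+1)], necessarily interior, the left-hand side of the scheme would be
    negative, while the upper bound on [dt] makes the right-hand side
    nonnegative.

    The value of the mass integrals is found without iterated integration.
    By uniqueness of translation-invariant measures, an affine bijection
    multiplies volumes by a constant. Exchanging two vertices of a simplex [K]
    preserves it, so [int L_i] does not depend on [i]; cutting [K] through
    the midpoint of the edge [ij] gives two halves affinely equivalent to [K],
    whence [2 int L_i L_j = int L_j^2]; and [sum_j L_j = 1] gives the rest. *)

Require Import Defs.
From HB Require Import structures.
From mathcomp Require Import all_boot all_order all_algebra.
From mathcomp Require Import all_classical all_reals all_analysis.
From mathcomp Require Import perm measurable_realfun ring lra.

Import Order.TTheory GRing.Theory Num.Theory.
Import numFieldNormedType.Exports.

Set Implicit Arguments.
Unset Strict Implicit.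
Unset Printing Implicit Defensive.

Local Open Scope classical_set_scope.
Local Open Scope ring_scope.

(** * Translation invariance of Lebesgue measure *)

(** The pushforward under the shift takes the right values on the intervals []b, c]], and these
    determine Lebesgue measure. *)
Lemma lebesgue_measure_shift (R : realType) (a : R) (A : set (measurableTypeR R)) :
  measurable A -> lebesgue_measure ((fun x => x + a) @^-1` A) = lebesgue_measure A.
Proof.
move=> mA; pose sh (x : measurableTypeR R) : measurableTypeR R := x + a.
have msh : measurable_fun setT sh by exact: measurable_funD.
pose nu := measure_function_pushforward__canonical__measure_function_Measure
  (@lebesgue_measure R) msh.
apply/esym; apply: (@lebesgue_measure_unique R nu) => // _ [[b c]] _ <-.
rewrite /nu/= /pushforward.
rewrite (_ : sh @^-1` _ = `]b - a, c - a]%classic).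
  rewrite !lebesgue_measure_itv/= !lte_fin ltrD2r -!EFinB.
  by rewrite (_ : c - a - (b - a) = c - b) //; ring.
by apply/seteqP; split => x /=; rewrite !in_itv/= /sh ltrBlDr lerBrDr.
Qed.

Definition translation_invariant (R : realType) n
    (mu : set 'rV[R]_n -> \bar R) :=
  forall (v : 'rV[R]_n) (A : set 'rV[R]_n), measurable A ->
    mu ((fun y => y + v) @^-1` A) = mu A.

Lemma measurable_preimage d1 d2 (T1 : measurableType d1) (T2 : measurableType d2)
    (h : T1 -> T2) (A : set T2) :
  measurable_fun setT h -> measurable A -> measurable (h @^-1` A).
Proof. by move=> mh mA; rewrite -[X in measurable X]setTI; exact: mh. Qed.

Section affine_maps.
Variable R : realType.

Lemma measurable_affine n m (A : 'M[R]_(n, m)) (v : 'rV[R]_m) :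
  measurable_fun [set: 'rV[R]_n] (fun y => y *m A + v).
Proof.
apply: measurable_rV_fun => i.
rewrite (_ : _ \o _ = fun y => \sum_k rV_coord k y * A k i + v ord0 i); last first.
  by apply/funext => y; rewrite /rV_coord /= !mxE; congr (_ + _); apply: eq_bigr.
apply: measurable_funD => //; apply: measurable_sum => k.
by apply: measurable_funM => //; exact: measurable_rV_coord.
Qed.

Lemma measurable_translation n (v : 'rV[R]_n) :
  measurable_fun [set: 'rV[R]_n] (fun y => y + v).
Proof.
rewrite (_ : (fun y => y + v) = (fun y => y *m 1%:M + v)).
  exact: measurable_affine.
by apply/funext => y; rewrite mulmx1.
Qed.

(** Induction on the dimension: through [rV_cons] a translation acts on the two factors of the
    product separately, and the product measure is determined by its values on rectangles. *)
Lemma lebesgue_rV_translation n : translation_invariant (lebesgue_rV R n).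
Proof.
elim: n => [|n IHn] v A mA.
  (* In dimension 0 every translation is the identity. *)
  rewrite (_ : (fun y => y + v) @^-1` A = A)//.
  by apply/funext => y /=; congr A; rewrite [RHS]thinmx0 [LHS]thinmx0.
pose a := v ord0 ord0; pose w : 'rV[R]_n := \row_i v ord0 (lift ord0 i).
pose sh (p : measurableTypeR R * 'rV[R]_n) : measurableTypeR R * 'rV[R]_n :=
  (p.1 + a, p.2 + w).
have msh : measurable_fun setT sh.
  apply/measurable_fun_pairP; split.
    by apply: measurable_funD => //; exact: measurable_fst.
  exact: measurableT_comp (measurable_translation w) measurable_snd.
have consD p : rV_cons (sh p) = rV_cons p + v.
  apply/rowP => i; rewrite [RHS]mxE; case: (unliftP ord0 i) => [j|] ->.
    have := rV_coordS_cons p j; have := rV_coordS_cons (sh p) j.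
    by rewrite /rV_coord => -> ->; rewrite !mxE.
  have := rV_coord0_cons p; have := rV_coord0_cons (sh p).
  by rewrite /rV_coord => -> ->.
rewrite /= /lebesgue_rV_step /pushforward.
pose nu := measure_function_pushforward__canonical__measure_function_Measure
  (@lebesgue_measure R \x lebesgue_rV R n)%E msh.
rewrite (_ : _ @^-1` _ = sh @^-1` ((@rV_cons R n) @^-1` A)); last first.
  by apply/seteqP; split => p /=; rewrite consD.
apply/esym; apply: (@product_measure_unique _ _ _ _ _ _ _ nu).
  move=> B C mB mC; rewrite /nu/= /pushforward.
  rewrite (_ : sh @^-1` _ =
    ((fun x => x + a) @^-1` B) `*` ((fun y => y + w) @^-1` C))//.
  rewrite product_measure1E//.
  - by congr (_ * _)%E; [exact: lebesgue_measure_shift | exact: IHn].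
  - by apply: measurable_preimage => //; apply: measurable_funD.
  - by apply: measurable_preimage => //; exact: measurable_translation.
by apply: measurable_preimage => //; exact: measurable_rV_cons.
Qed.

End affine_maps.

(** * Uniqueness of translation-invariant measures *)

Section haar.
Variables (R : realType) (n : nat).
Local Notation lambda := (lebesgue_rV R n).

Definition cube (r : R) : set 'rV[R]_n := [set y | forall i, - r <= y ord0 i <= r].

Lemma measurable_box (a b : 'I_n -> R) :
  measurable [set y : 'rV[R]_n | forall i, a i <= y ord0 i <= b i].
Proof.
rewrite (_ : [set _ | _] = \bigcap_(i in [set: 'I_n])
    (@rV_coord R n i @^-1` `[a i, b i]%classic)).
  apply: fin_bigcap_measurable => //= i _.
  exact: measurable_preimage (measurable_rV_coord _) (measurable_itv _).
apply/seteqP; split=> x /= h i; first by move=> _; rewrite /= in_itv/=; exact: h.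
by have := h i I; rewrite /= in_itv.
Qed.

Lemma measurable_cube r : measurable (cube r).
Proof. exact: measurable_box. Qed.

Lemma lebesgue_cube r : 0 <= r -> lambda (cube r) = ((r + r) ^+ n)%:E.
Proof.
move=> r0; rewrite [LHS](@lebesgue_rV_box R n (fun=> - r) (fun=> r)).
  by congr (_%:E); under eq_bigr do rewrite opprK; rewrite prodr_const card_ord.
by move=> _; lra.
Qed.

(* Fubini for the map (x, y) |-> x + y shows
   lambda A * nu C = nu A * lambda (- C); the unit cube C is symmetric. *)
Lemma translation_invariant_unique
    (nu : {sigma_finite_measure set 'rV[R]_n -> \bar R}) (A : set 'rV[R]_n) :
  translation_invariant nu -> measurable A ->
  nu A = (nu (cube 2^-1) * lambda A)%E.
Proof.
move=> nuT mA; pose C := cube 2^-1; have mC : measurable C := measurable_cube _.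
have madd : measurable_fun setT (fun p : 'rV[R]_n * 'rV[R]_n => p.1 + p.2).
  apply: measurable_rV_fun => i.
  rewrite (_ : _ \o _ = fun p => rV_coord i p.1 + rV_coord i p.2); last first.
    by apply/funext => p; rewrite /rV_coord /= !mxE.
  apply: measurable_funD.
    exact: measurableT_comp (measurable_rV_coord i) measurable_fst.
  exact: measurableT_comp (measurable_rV_coord i) measurable_snd.
have msub : measurable_fun setT (fun p : 'rV[R]_n * 'rV[R]_n => p.2 - p.1).
  apply: measurable_rV_fun => i.
  rewrite (_ : _ \o _ = fun p => rV_coord i p.2 - rV_coord i p.1); last first.
    by apply/funext => p; rewrite /rV_coord /= !mxE.
  apply: measurable_funB.
    exact: measurableT_comp (measurable_rV_coord i) measurable_snd.
  exact: measurableT_comp (measurable_rV_coord i) measurable_fst.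
(* For fixed [x], the section of [F] is that of [E] translated by [x], so both have the same
   [nu]-measure. For fixed [y], the section of [E] is empty or a translate of [A], and that of [F]
   is empty or a translate of [C]. *)
pose E : set ('rV[R]_n * 'rV[R]_n) :=
  (fun p => p.1 + p.2) @^-1` A `&` snd @^-1` C.
have mE : measurable E.
  apply: measurableI; first exact: measurable_preimage madd mA.
  exact: measurable_preimage measurable_snd mC.
pose F : set ('rV[R]_n * 'rV[R]_n) :=
  snd @^-1` A `&` (fun p => p.2 - p.1) @^-1` C.
have mF : measurable F.
  apply: measurableI; last exact: measurable_preimage msub mC.
  exact: measurable_preimage measurable_snd mA.
have swap (G : set ('rV[R]_n * 'rV[R]_n)) : measurable G ->
    (\int[lambda]_x nu (xsection G x) = \int[nu]_y lambda (ysection G y))%E.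
  move=> mG; have := indic_fubini_tonelli lambda nu mG.
  by rewrite indic_fubini_tonelli_FE // indic_fubini_tonelli_GE.
have intC (c : \bar R) (B : set 'rV[R]_n) (h : 'rV[R]_n -> \bar R) : (0 <= c)%E ->
    measurable B -> (forall y, h y = if y \in B then c else 0%E) ->
    (\int[nu]_y h y = c * nu B)%E.
  move=> c0 mB hE; rewrite -integral_cst// [RHS]integral_mkcond.
  by apply: eq_integral => y _; rewrite hE patchE.
have lC : lambda C = 1%E.
  rewrite lebesgue_cube ?invr_ge0 //.
  by rewrite (_ : 2^-1 + 2^-1 = 1 :> R) ?expr1n//; field.
have E1 : (\int[nu]_y lambda (ysection E y) = lambda A * nu C)%E.
  apply: intC => // y; case: ifPn => yC.
    rewrite -(lebesgue_rV_translation y mA); congr (lambda _).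
    apply/seteqP; split => x; rewrite /ysection /E /=; rewrite ?inE/=.
      by case.
    by move=> ?; split => //; exact/set_mem.
  rewrite (_ : ysection _ _ = set0) ?measure0//; apply/seteqP; split => x //.
  rewrite /ysection /E /= inE /= => -[_ Cy].
  by move: yC; rewrite notin_setE.
have F1 : (\int[nu]_y lambda (ysection F y) = nu A)%E.
  rewrite -[RHS]mul1e; apply: intC => // y; case: ifPn => yA.
    rewrite -lC -(lebesgue_rV_translation (- y) mC); congr (lambda _).
    apply/seteqP; split => x; rewrite /ysection /F /=; rewrite ?inE/=.
      by move=> [_ h] i; have := h i; rewrite !mxE; lra.
    move=> h; split; first exact/set_mem.
    by move=> i; have := h i; rewrite !mxE; lra.
  rewrite (_ : ysection _ _ = set0) ?measure0//; apply/seteqP; split => x //.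
  rewrite /ysection /F /= inE /= => -[Ay _].
  by move: yA; rewrite notin_setE.
rewrite muleC -E1 -F1 -!swap//; apply: eq_integral => x _.
rewrite -[LHS](nuT x); last by apply: measurable_xsection.
congr (nu _); apply/seteqP; split => y; rewrite /xsection /E /F /= !inE/=.
  by rewrite addrK addrC.
by rewrite addrK addrC.
Qed.

Lemma bounded_coord_lebesgue_fin (A : set 'rV[R]_n) (r : R) : measurable A ->
  A `<=` cube r -> (lambda A < +oo)%E.
Proof.
move=> mA Ar; have [r0|r0] := leP 0 r.
  apply: (@le_lt_trans _ _ (lambda (cube r))); last by rewrite lebesgue_cube ?ltry.
  by apply: le_measure; rewrite ?inE//; exact: measurable_cube.
(* For [r < 0] the cube is empty if [n > 0] and the one-point space if [n = 0]; either way it lies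
   in [cube 0]. *)
apply: (@le_lt_trans _ _ (lambda (cube 0))); last by rewrite lebesgue_cube ?ltry.
apply: le_measure; rewrite ?inE//; first exact: measurable_cube.
by move=> y /Ar h i; have := h i; lra.
Qed.

End haar.

(** * Affine changes of variables and hyperplanes *)

Section affine_change_of_variables.
Variables (R : realType) (n : nat) (A B : 'M[R]_n) (v w : 'rV[R]_n).
Local Notation lambda := (lebesgue_rV R n).
Let T (y : 'rV[R]_n) := y *m A + v.
Let S (y : 'rV[R]_n) := y *m B + w.
Hypotheses (TK : cancel T S) (SK : cancel S T).

Let measurable_T : measurable_fun setT T.
Proof. exact: measurable_affine. Qed.

Let measurable_S : measurable_fun setT S.
Proof. exact: measurable_affine. Qed.

Let nu : set 'rV[R]_n -> \bar R := pushforward lambda T.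
HB.instance Definition _ := Measure.copy nu
  (measure_function_pushforward__canonical__measure_function_Measure
     lambda measurable_T).

Let nu_sigma_finite : sigma_finite setT nu.
Proof.
have /sigma_finiteP[F [UF ndF mF]] := sigma_finiteT lambda.
exists (fun k => S @^-1` (F k)); first by rewrite -preimage_bigcup -UF preimage_setT.
move=> k; have [mFk Fk] := mF k; split; first exact: measurable_preimage.
rewrite /nu /pushforward -comp_preimage (_ : S \o T = id) ?preimage_id//.
by apply/funext => y /=; exact: TK.
Qed.

HB.instance Definition _ := Measure_isSigmaFinite.Build _ _ _ nu nu_sigma_finite.

(** The linear part [B] of [S] inverts that of [T], so translating by [z] after [T] amounts to
    translating by [z *m B] before it. *)
Let nu_translation : translation_invariant nu.
Proof.
move=> z E mE; rewrite /nu /pushforward.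
rewrite -[RHS](lebesgue_rV_translation (z *m B)); last exact: measurable_preimage.
suff TD y : T (y + z *m B) = T y + z.
  by congr (lambda _); apply/seteqP; split => y /=; rewrite TD.
by apply: (can_inj SK); rewrite TK /S mulmxDl addrAC -/(S (T y)) TK.
Qed.

(** As [y = S (T y)], the entries of [B] and [w] bound the coordinates of [y] once those of [T y]
    are bounded; summing the bounds over [i] gives a single radius. *)
Let S_cube : exists r, T @^-1` cube 2^-1 `<=` cube r.
Proof.
pose r i := \sum_k `|B k i| + `|w ord0 i|.
exists (\sum_i r i) => y Ty i; rewrite -ler_norml -[y]TK /S mxE.
have le_r : r i <= \sum_i r i.
  rewrite (bigD1 i)//= lerDl sumr_ge0// => j _.
  by rewrite addr_ge0// sumr_ge0.
apply: le_trans le_r; apply: le_trans (ler_normD _ _) _; rewrite lerD2r.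
rewrite mxE; apply: le_trans (ler_norm_sum _ _ _) _; apply: ler_sum => k _.
rewrite normrM ler_piMl// ler_norml; have := Ty k; rewrite /T.
by lra.
Qed.

(** The pushforward of Lebesgue measure under [T] is translation invariant, hence a multiple of it.
    The factor [c] is not identified with a determinant; it is later read off from one set whose
    preimage is known. *)
Lemma affine_change_of_variables : exists2 c : {nonneg R},
  forall D, measurable D -> lambda (T @^-1` D) = (c%:num%:E * lambda D)%E &
  forall D f, measurable D -> measurable_fun D f -> (forall y, D y -> 0 <= f y)%E ->
    (\int[lambda]_(y in T @^-1` D) f (T y) = c%:num%:E * \int[lambda]_(y in D) f y)%E.
Proof.
have nu_fin : (nu (cube 2^-1) < +oo)%E.
  have [r Tr] := S_cube; apply: (bounded_coord_lebesgue_fin _ Tr).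
  by apply: measurable_preimage => //; exact: measurable_cube.
pose c := NngNum (fine_ge0 (measure_ge0 nu (cube 2^-1))).
have cE D : measurable D -> nu D = (c%:num%:E * lambda D)%E.
  move=> mD; rewrite (translation_invariant_unique (nu := nu) nu_translation mD).
  by rewrite /c /= fineK// ge0_fin_numE.
exists c => // D f mD mf f0.
rewrite -[LHS](ge0_integral_pushforward (phi := T))//; last first.
  by move=> y; rewrite inE; exact: f0.
rewrite -ge0_integral_mscale//.
by apply: (eq_measure_integral (mscale c lambda)) => E mE _; exact: cE.
Qed.

End affine_change_of_variables.

Section affine_form.
Variable R : realType.

Definition affine_form n (b : 'cV[R]_n) (c : R) (y : 'rV[R]_n) : R :=
  (y *m b) 0 0 + c.

Lemma affine_form_sum n (J : finType) (P : pred J) (b : 'cV[R]_n) c (a : J -> R)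
    (q : J -> 'rV[R]_n) : \sum_(l | P l) a l = 1 ->
  affine_form b c (\sum_(l | P l) a l *: q l) =
  \sum_(l | P l) a l * affine_form b c (q l).
Proof.
move=> a1; rewrite /affine_form mulmx_suml summxE.
under [RHS]eq_bigr do rewrite mulrDr.
rewrite big_split/= -mulr_suml a1 mul1r; congr (_ + _).
by apply: eq_bigr => l _; rewrite -scalemxAl mxE.
Qed.

Lemma affine_form_inj n (b b' : 'cV[R]_n) c c' :
  (forall y, affine_form b c y = affine_form b' c' y) -> b = b' /\ c = c'.
Proof.
move=> e; have cE : c = c'.
  by have := e 0; rewrite /affine_form !mul0mx !mxE !add0r.
split=> //; apply/colP => k; have := e (delta_mx 0 k).
rewrite /affine_form -!rowE cE => /addIr.
by rewrite !mxE.
Qed.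

Lemma measurable_affine_form n (b : 'cV[R]_n) c :
  measurable_fun [set: 'rV[R]_n] (affine_form b c).
Proof.
rewrite (_ : affine_form b c = fun y => \sum_k rV_coord k y * b k 0 + c).
  apply: measurable_funD => //; apply: measurable_sum => k.
  by apply: measurable_funM => //; exact: measurable_rV_coord.
by apply/funext => y; rewrite /affine_form mxE.
Qed.

Lemma measurable_hyperplane n (b : 'cV[R]_n) c :
  measurable [set y | affine_form b c y = 0].
Proof.
rewrite (_ : [set _ | _] = affine_form b c @^-1` [set 0])//.
exact: measurable_preimage (measurable_affine_form _ _) _.
Qed.

(** Induction on the dimension, slicing at the first coordinate. If some other coefficient of [b] is
    nonzero, every slice is a null hyperplane; otherwise the set is one point of the line times the
    remaining space. *)
Lemma lebesgue_hyperplane n (b : 'cV[R]_n) c : b != 0 ->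
  lebesgue_rV R n [set y | affine_form b c y = 0] = 0%E.
Proof.
elim: n b c => [|n IHn] b c b0.
  by case/eqP: b0; apply/matrixP => -[].
have mH := measurable_hyperplane b c.
rewrite /= /lebesgue_rV_step /pushforward.
pose b' : 'cV[R]_n := \col_i b (lift ord0 i) 0.
have affE p : affine_form b c (rV_cons p) = affine_form b' (p.1 * b ord0 0 + c) p.2.
  rewrite /affine_form !mxE big_ord_recl -[rV_cons p _ _]/(rV_coord ord0 (rV_cons p)).
  rewrite rV_coord0_cons addrCA addrA; congr (_ + _ + _); apply: eq_bigr => i _.
  by rewrite -[rV_cons p _ _]/(rV_coord _ (rV_cons p)) rV_coordS_cons mxE.
have [b'0|b'0] := eqVneq b' 0.
  have b00 : b ord0 0 != 0.
    apply: contraNneq b0 => b00; apply/eqP/colP => i; rewrite mxE.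
    case: (unliftP ord0 i) => [j|] ->; last exact: b00.
    by move/matrixP: b'0 => /(_ j 0); rewrite !mxE.
  rewrite (_ : _ @^-1` _ = [set - c / b ord0 0] `*` setT).
    rewrite product_measure1E// [X in (X * _)%E](_ : _ = 0%E) ?mul0e//.
    exact: lebesgue_measure_set1.
  apply/seteqP; split => -[a x] /=; rewrite affE b'0 /affine_form mulmx0 mxE add0r/=.
    by move=> h; split => //; apply: (mulIf b00); rewrite divfK//; lra.
  by move=> [-> _]; rewrite divfK// addNr.
rewrite /product_measure1 integral0_eq// => a _ /=.
rewrite (_ : xsection _ _ = [set y | affine_form b' (a * b ord0 0 + c) y = 0]).
  exact: IHn.
by apply/seteqP; split => x; rewrite /xsection /= inE/= affE.
Qed.

End affine_form.

Lemma nbhs_rVP (R : realType) n (y : 'rV[R]_n) (U : set 'rV[R]_n) : nbhs y U <->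
  exists2 e : R, 0 < e & forall z : 'rV[R]_n, (forall i, `|y ord0 i - z ord0 i| < e) -> U z.
Proof.
split=> [/nbhs_ballP[e e0 yU]|[e e0 yU]].
  by exists e => // z h; apply: yU; split => // i j; rewrite (ord1 i); exact: h.
apply/nbhs_ballP; exists e => // z h.
by apply: yU => i; case: h => _ /(_ ord0 i).
Qed.

(** An open set is the countable union of the closed boxes it contains that have a rational centre
    and a radius [k.+1%:R^-1]; boxes are measurable for the sigma-algebra generated by the
    coordinates. *)
Lemma open_measurable_rV (R : realType) n (U : set 'rV[R]_n) : open U -> measurable U.
Proof.
move=> oU.
pose box (p : 'rV[rat]_n * nat) : set 'rV[R]_n := [set z | forall i,
  ratr (p.1 ord0 i) - p.2.+1%:R^-1 <= z ord0 i <= ratr (p.1 ord0 i) + p.2.+1%:R^-1].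
rewrite (_ : U = \bigcup_(p : 'rV[rat]_n * nat) if `[< box p `<=` U >] then box p else set0).
  apply: countable_bigcupT_measurable; first exact: countableP.
  by move=> p; case: ifP => // _; exact: measurable_box.
apply/seteqP; split => [z Uz|z [p _]]; last by case: ifPn => // /asboolP; exact.
have /nbhs_rVP[e e0 zU] : nbhs z U by exact: open_nbhs_nbhs.
(* The centre will be within [r] of [z], and points of the box are within [r] of the centre: hence
   the requirement [r + r < e]. *)
pose k := Num.truncn (2 / e); pose r : R := k.+1%:R^-1.
have r0 : 0 < r by rewrite invr_gt0.
have re : r + r < e.
  have : 2 / e < k.+1%:R by exact: truncnS_gt.
  rewrite ltr_pdivrMr// mulrC -ltr_pdivrMr// -/r.
  by rewrite mulrDl mul1r.
have /choice[q qP] : forall i, exists a : rat, z ord0 i - r < ratr a < z ord0 i + r.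
  move=> i; have /rat_in_itvoo[a] : z ord0 i - r < z ord0 i + r by lra.
  by rewrite in_itv => ?; exists a.
exists (\row_i q i, k) => //; case: ifPn => [_|].
  by move=> i /=; rewrite mxE -/r; have := qP i; lra.
move=> /negP; case; apply/asboolP => y /= yq; apply: zU => i.
have := yq i; rewrite mxE -/r; have := qP i; rewrite ltr_norml; lra.
Qed.

(** * Barycentric coordinates *)

Section barycentric.
Variables (R : realType) (n : nat) (I : finType) (K : {set I}).
Variables (p : I -> 'rV[R]_n) (b : I -> 'cV[R]_n) (c : I -> R).
Hypothesis cardK : #|K| = n.+1.
Let L k := affine_form (b k) (c k).
Hypothesis L_vertex : forall i j, i \in K -> j \in K -> L j (p i) = (i == j)%:R.
Local Notation lambda := (lebesgue_rV R n).

(* The coefficients of the L_j and the homogeneous coordinates of the vertices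
   are inverse square matrices; the order of the product can be reversed. *)
Let barycentric_mx y : \sum_(k in K) L k y = 1 /\ \sum_(k in K) L k y *: p k = y.
Proof.
pose e (i : 'I_n.+1) : I := enum_val (cast_ord (esym cardK) i).
have eK i : e i \in K by exact: enum_valP.
have e_inj : injective e by move=> i j /enum_val_inj/cast_ord_inj.
have e_sum (V : nmodType) (F : I -> V) : \sum_(k in K) F k = \sum_i F (e i).
  rewrite big_enum_val (reindex (cast_ord (esym cardK)))//=.
  by exists (cast_ord cardK) => i _; rewrite ?cast_ordK ?cast_ordKV.
pose P : 'M[R]_(1 + n) := \matrix_i row_mx 1%:M (p (e i)).
pose Q : 'M[R]_(1 + n) := \matrix_(i, j) (col_mx (c (e j))%:M (b (e j))) i 0.
have Pl i : P i (lshift n ord0) = 1 by rewrite mxE row_mxEl mxE.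
have Pr i k : P i (rshift 1 k) = p (e i) ord0 k by rewrite mxE row_mxEr.
have Ql j : Q (lshift n ord0) j = c (e j) by rewrite mxE col_mxEu mxE.
have Qr k j : Q (rshift 1 k) j = b (e j) k 0 by rewrite mxE col_mxEd.
have PQ : P *m Q = 1%:M.
  apply/matrixP => i j; rewrite [RHS]mxE -(inj_eq e_inj) -L_vertex//.
  rewrite /L /affine_form mxE big_split_ord/= big_ord1 addrC Pl Ql mul1r mxE.
  by congr (_ + _); apply: eq_bigr => k _; rewrite Pr Qr.
have {PQ} QP := mulmx1C PQ.
have yQ i : (row_mx 1%:M y *m Q) 0 i = L (e i) y.
  rewrite mxE big_split_ord/= big_ord1 addrC /L /affine_form row_mxEl Ql.
  rewrite [1%:M 0 0]mxE mul1r mxE.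
  by congr (_ + _); apply: eq_bigr => k _; rewrite row_mxEr Qr.
have yP : row_mx 1%:M y *m Q *m P = row_mx 1%:M y by rewrite -mulmxA QP mulmx1.
split.
  have -> : 1 = row_mx 1%:M y 0 (lshift n ord0) by rewrite row_mxEl mxE.
  rewrite -[in RHS]yP.
  by rewrite e_sum mxE; apply: eq_bigr => i _; rewrite yQ Pl mulr1.
apply/rowP => j; move/matrixP: yP => /(_ 0 (rshift 1 j)); rewrite row_mxEr => <-.
by rewrite e_sum summxE mxE; apply: eq_bigr => i _; rewrite yQ Pr mxE.
Qed.

Lemma barycentric_sum1 y : \sum_(k in K) L k y = 1.
Proof. by have [] := barycentric_mx y. Qed.

Lemma barycentric_comb y : \sum_(k in K) L k y *: p k = y.
Proof. by have [] := barycentric_mx y. Qed.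

Lemma barycentric_coord (a : I -> R) k : \sum_(l in K) a l = 1 -> k \in K ->
  L k (\sum_(l in K) a l *: p l) = a k.
Proof.
move=> a1 kK; rewrite /L affine_form_sum// (bigD1 k)//= -/(L k _) L_vertex//.
rewrite eqxx mulr1 big1 ?addr0// => l /andP[lK lk].
by rewrite -/(L k _) L_vertex// (negbTE lk) mulr0.
Qed.

Lemma hull_barycentric : hull p K = [set y | forall k, k \in K -> 0 <= L k y].
Proof.
apply/seteqP; split => [y [a [a0 a1 ->]] k kK|y y0].
  by rewrite barycentric_coord//; exact: a0.
exists (L^~ y); split => //; first exact: barycentric_sum1.
by rewrite barycentric_comb.
Qed.

(** The simplex without its faces. Integrals over elements are computed on this set, because near
    each of its points the basis functions are affine. *)
Definition open_simplex : set 'rV[R]_n := [set y | forall k, k \in K -> 0 < L k y].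
Local Notation S := open_simplex.

Lemma open_simplexW y k : S y -> k \in K -> 0 <= L k y <= 1.
Proof.
move=> Sy kK; rewrite ltW ?Sy//= -(barycentric_sum1 y) (bigD1 k)//= lerDl.
by apply: sumr_ge0 => l /andP[lK _]; apply/ltW/Sy.
Qed.

Lemma measurable_open_simplex : measurable S.
Proof.
rewrite (_ : S = \bigcap_(k in [set k | k \in K]) (L k @^-1` `]0, +oo[%classic)).
  apply: fin_bigcap_measurable; first exact: finite_finset.
  move=> k _; apply: measurable_preimage; last exact: measurable_itv.
  exact: measurable_affine_form.
apply/seteqP; split => y /= h k kK; have := h k kK; first by rewrite /= in_itv/= andbT.
by rewrite /= in_itv/= andbT.
Qed.

Lemma open_simplex_fin : (lambda S < +oo)%E.
Proof.
pose r i := \sum_(k in K) `|p k ord0 i|.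
apply: (@bounded_coord_lebesgue_fin _ _ _ (\sum_i r i)).
  exact: measurable_open_simplex.
move=> y Sy i; rewrite -ler_norml -[y]barycentric_comb summxE.
apply: (@le_trans _ _ (r i)); last first.
  rewrite (bigD1 i)//= lerDl sumr_ge0// => j _.
  by rewrite sumr_ge0.
apply: le_trans (ler_norm_sum _ _ _) _; apply: ler_sum => k kK.
rewrite mxE normrM ler_piMl//; have /andP[l0 l1] := open_simplexW Sy kK.
by rewrite ger0_norm.
Qed.

Definition barycenter := n.+1%:R^-1 *: \sum_(k in K) p k.

Lemma barycenter_coord k : k \in K -> L k barycenter = n.+1%:R^-1.
Proof.
move=> kK; rewrite /barycenter scaler_sumr barycentric_coord//.
by rewrite sumr_const cardK -[RHS](@mulVf _ (n.+1%:R))// mulr_natr.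
Qed.

Lemma open_simplex_nbhs y : S y -> nbhs y S.
Proof.
move=> Sy; apply/nbhs_rVP.
pose m := \big[Num.min/1]_(k in K) L k y.
have m0 : 0 < m by apply: lt_bigmin => // k kK; exact: Sy.
(* [M] exceeds the sum of the absolute coefficients of each [L k], strictly because of the summand
   1. A move of less than [m / M] in every coordinate therefore changes each [L k] by less than its
   least value [m]. *)
pose M := 1 + \sum_(k in K) \sum_i `|b k i 0|.
have M0 : 0 < M.
  by rewrite ltr_pwDl// sumr_ge0// => k _; rewrite sumr_ge0.
exists (m / M) => [|z yz k kK]; first exact: divr_gt0.
have mk : m <= L k y by exact: bigmin_le_cond.
suff : `|L k y - L k z| < m by rewrite ltr_norml; lra.
rewrite /L /affine_form opprD addrACA subrr addr0 !mxE -sumrB.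
apply: le_lt_trans (ler_norm_sum _ _ _) _.
apply: (@le_lt_trans _ _ (m / M * \sum_i `|b k i 0|)).
  rewrite mulr_sumr; apply: ler_sum => i _.
  by rewrite -mulrBl normrM ler_wpM2r// ltW.
rewrite mulrAC ltr_pdivrMr// ltr_pM2l// /M.
apply: ltr_pwDl => //; rewrite (bigD1 k)//= lerDl.
by apply: sumr_ge0 => l _; apply: sumr_ge0.
Qed.

Lemma barycenter_open_simplex : S barycenter.
Proof. by move=> k kK; rewrite barycenter_coord// invr_gt0. Qed.

(** The barycenter is an interior point, so a small box around it fits inside. *)
Lemma open_simplex_gt0 : (0 < lambda S)%E.
Proof.
have /nbhs_rVP[e e0 yS] := open_simplex_nbhs barycenter_open_simplex.
pose y := barycenter.
pose lo i := y ord0 i - e / 2; pose hi i := y ord0 i + e / 2.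
pose B := [set z : 'rV[R]_n | forall i, lo i <= z ord0 i <= hi i].
have : (0 < lambda B)%E.
  rewrite lebesgue_rV_box => [|i]; last by rewrite /lo /hi; lra.
  by rewrite lte_fin prodr_gt0// => i _; rewrite /lo /hi; lra.
move=> /lt_le_trans; apply; apply: le_measure; rewrite ?inE.
- exact: measurable_box.
- exact: measurable_open_simplex.
move=> z zb; apply: yS => i; have := zb i; rewrite -/y /lo /hi ltr_norml; lra.
Qed.

End barycentric.

(** * Integrals of barycentric coordinates *)

Section Rintegral_sum.
Context d (T : measurableType d) (R : realType) (mu : {measure set T -> \bar R}).
Variables (D : set T) (J : Type) (P : pred J) (F : J -> T -> R).
Hypotheses (mD : measurable D)
  (iF : forall j, P j -> mu.-integrable D (EFin \o F j)).

Lemma integrable_Rsum (s : seq J) :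
  mu.-integrable D (EFin \o fun y => \sum_(j <- s | P j) F j y).
Proof.
apply: (eq_integrable mD _ _ _ (integrable_sum mD s iF)) => y _.
by rewrite /= sumEFin.
Qed.

Lemma Rintegral_sum (s : seq J) :
  \int[mu]_(y in D) \sum_(j <- s | P j) F j y = \sum_(j <- s | P j) \int[mu]_(y in D) F j y.
Proof.
elim: s => [|j s IHs].
  rewrite big_nil (@eq_Rintegral _ _ _ mu D (fun=> 0)) => [|y _]; last by rewrite big_nil.
  by rewrite Rintegral_cst// mul0r.
under eq_Rintegral do rewrite big_cons.
rewrite big_cons; case: ifPn => // Pj.
rewrite RintegralD//; first by rewrite IHs.
  exact: iF.
exact: integrable_Rsum.
Qed.

End Rintegral_sum.

Section simplex_integrals.
Variables (R : realType) (n : nat) (I : finType) (K : {set I}).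
Variables (p : I -> 'rV[R]_n) (b : I -> 'cV[R]_n) (c : I -> R).
Hypothesis cardK : #|K| = n.+1.
Let L k := affine_form (b k) (c k).
Hypothesis L_vertex : forall i j, i \in K -> j \in K -> L j (p i) = (i == j)%:R.
Local Notation lambda := (lebesgue_rV R n).
Local Notation S := (open_simplex K b c).

Let mS : measurable S := measurable_open_simplex K b c.
Let L01 y k : S y -> k \in K -> 0 <= L k y <= 1.
Proof. exact: (open_simplexW cardK L_vertex). Qed.

Let mL k : measurable_fun setT (L k).
Proof. exact: measurable_affine_form. Qed.

(** The affine map sending each vertex [p k] to [q k]. *)
Definition barycentric_map (q : I -> 'rV[R]_n) y := \sum_(k in K) L k y *: q k.

Lemma barycentric_mapE q y :
  barycentric_map q y = y *m (\sum_(k in K) b k *m q k) + \sum_(k in K) c k *: q k.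
Proof.
rewrite mulmx_sumr -big_split/=; apply: eq_bigr => k _.
by rewrite mulmxA [y *m b k]mx11_scalar mul_scalar_mx -scalerDl.
Qed.

Lemma barycentric_map_sum q (a : I -> R) (r : I -> 'rV[R]_n) :
  \sum_(k in K) a k = 1 ->
  barycentric_map q (\sum_(k in K) a k *: r k) =
  \sum_(k in K) a k *: barycentric_map q (r k).
Proof.
move=> a1; under [RHS]eq_bigr do rewrite scaler_sumr.
rewrite exchange_big; apply: eq_bigr => k _.
rewrite /L affine_form_sum// scaler_suml.
by apply: eq_bigr => l _; rewrite scalerA.
Qed.

Lemma barycentric_map_vertex q k : k \in K -> barycentric_map q (p k) = q k.
Proof.
move=> kK; rewrite /barycentric_map (bigD1 k)//= L_vertex// eqxx scale1r.
rewrite big1 ?addr0// => l /andP[lK lk].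
by rewrite L_vertex// eq_sym (negbTE lk) scale0r.
Qed.

(** The composite is affine and fixes every vertex, hence it is the identity. *)
Lemma barycentric_mapK q r : (forall k, k \in K -> barycentric_map r (q k) = p k) ->
  cancel (barycentric_map q) (barycentric_map r).
Proof.
move=> rq y; rewrite {2}/barycentric_map barycentric_map_sum.
  rewrite -[RHS](barycentric_comb cardK L_vertex y).
  by apply: eq_bigr => k kK; rewrite rq.
exact: (barycentric_sum1 cardK L_vertex y).
Qed.

Lemma coord_barycentric_map q y k : L k (barycentric_map q y) =
  \sum_(l in K) L l y * L k (q l).
Proof. exact: (affine_form_sum _ _ _ (barycentric_sum1 cardK L_vertex y)). Qed.

Lemma barycentric_change_of_variables q r :
  (forall k, k \in K -> barycentric_map r (q k) = p k) ->
  (forall k, k \in K -> barycentric_map q (r k) = p k) ->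
  exists2 s : {nonneg R},
  forall D, measurable D -> lambda (barycentric_map q @^-1` D) = (s%:num%:E * lambda D)%E &
  forall D f, measurable D -> measurable_fun D f -> (forall y, D y -> 0 <= f y)%E ->
    (\int[lambda]_(y in barycentric_map q @^-1` D) f (barycentric_map q y) =
     s%:num%:E * \int[lambda]_(y in D) f y)%E.
Proof.
move=> rq qr.
have qE := funext (barycentric_mapE q); have rE := funext (barycentric_mapE r).
have := barycentric_mapK qr; have := barycentric_mapK rq.
by rewrite qE rE => qK rK; exact: affine_change_of_variables qK rK.
Qed.

Lemma open_simplex_bounded_integrable (D : set 'rV[R]_n)
    (F : 'rV[R]_n -> R) (M : R) : measurable D -> D `<=` S ->
  measurable_fun setT F -> (forall y, D y -> `|F y| <= M) ->
  lambda.-integrable D (EFin \o F).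
Proof.
move=> mD DS mF FM; apply: measurable_bounded_integrable => //.
- apply: le_lt_trans (open_simplex_fin cardK L_vertex).
  by apply: le_measure; rewrite ?inE.
- exact: measurable_funTS.
- exists M; split; first exact: num_real.
  by move=> M' MM' y /FM; move/le_trans; apply; exact: ltW.
Qed.

Let volS := fine (lambda S).

Let volSE : lambda S = volS%:E.
Proof. by rewrite fineK// ge0_fin_numE// (open_simplex_fin cardK L_vertex). Qed.

Let volS_gt0 : 0 < volS.
Proof. by rewrite -lte_fin -volSE (open_simplex_gt0 cardK L_vertex). Qed.

Lemma integrable_coord_mul D i j : measurable D -> D `<=` S -> i \in K -> j \in K ->
  lambda.-integrable D (EFin \o (fun y => L i y * L j y)).
Proof.
move=> mD DS iK jK; apply: (@open_simplex_bounded_integrable _ _ 1) => //.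
  exact: measurable_funM.
move=> y /DS Sy; have /andP[i0 i1] := L01 Sy iK; have /andP[j0 j1] := L01 Sy jK.
by rewrite ger0_norm ?mulr_ge0// mulr_ile1.
Qed.

Lemma integrable_coord D i : measurable D -> D `<=` S -> i \in K ->
  lambda.-integrable D (EFin \o L i).
Proof.
move=> mD DS iK; apply: (@open_simplex_bounded_integrable _ _ 1) => //.
by move=> y /DS Sy; have /andP[i0 i1] := L01 Sy iK; rewrite ger0_norm.
Qed.

Let RE D (F : 'rV[R]_n -> R) : measurable D -> lambda.-integrable D (EFin \o F) ->
  (\int[lambda]_(y in D) (F y)%:E)%E = (\int[lambda]_(y in D) F y)%:E.
Proof. by move=> mD iF; rewrite fineK//; exact: integrable_fin_num. Qed.

(** * Exchange of two vertices and bisection of a simplex *)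

Section transposition.
Variables i j : I.
Hypotheses (iK : i \in K) (jK : j \in K) (ij : i != j).

Let tau := barycentric_map (p \o tperm i j).

Let tperm_in k : k \in K -> tperm i j k \in K.
Proof. by move=> kK; case: tpermP => // ->. Qed.

Let tauL k y : k \in K -> L k (tau y) = L (tperm i j k) y.
Proof.
move=> kK; rewrite coord_barycentric_map (bigD1 (tperm i j k)) ?tperm_in//=.
rewrite tpermK L_vertex// eqxx mulr1 big1 ?addr0// => l /andP[lK lk].
rewrite L_vertex ?tperm_in// (_ : _ == k = false) ?mulr0//.
by apply: contra_neqF lk => /eqP <-; rewrite tpermK.
Qed.

Let tau_vertex k : k \in K -> tau ((p \o tperm i j) k) = p k.
Proof. by move=> kK; rewrite /tau barycentric_map_vertex ?tperm_in//= tpermK. Qed.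

Let tau_S y : S (tau y) <-> S y.
Proof.
split=> Sy k kK; last by rewrite -/(L k _) tauL//; exact/Sy/tperm_in.
by rewrite -/(L k _) -(tpermK i j k) -tauL ?tperm_in//; exact/Sy/tperm_in.
Qed.

(* The change of variables exchanging two vertices maps the simplex to itself,
   so its Jacobian is 1. *)
Let tau_invariance :
  (forall D, measurable D -> lambda (tau @^-1` D) = lambda D) /\
  (forall D f, measurable D -> measurable_fun D f -> (forall y, D y -> 0 <= f y)%E ->
    \int[lambda]_(y in tau @^-1` D) f (tau y) = \int[lambda]_(y in D) f y)%E.
Proof.
have [s sD sf] := barycentric_change_of_variables tau_vertex tau_vertex.
have s1 : s%:num = 1.
  have := sD S mS; rewrite (_ : _ @^-1` S = S); last first.
    by apply/seteqP; split => y /tau_S.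
  by rewrite volSE => -[] /(canLR (mulfK (lt0r_neq0 volS_gt0))); rewrite divff ?lt0r_neq0.
split=> [D mD|D f mD mf f0]; first by rewrite sD// s1 mul1e.
by rewrite sf// s1 mul1e.
Qed.

(** The substitution [tau] preserves [S] and volumes, and turns [L j] into [L i]. *)
Lemma integral_coord_sym :
  \int[lambda]_(y in S) L i y = \int[lambda]_(y in S) L j y.
Proof.
congr fine; have [_ h] := tau_invariance.
rewrite -[RHS]h//.
- rewrite (_ : tau @^-1` S = S); last by apply/seteqP; split => y /tau_S.
  by apply: eq_integral => y _; rewrite tauL// tpermR.
- exact/measurable_EFinP/measurable_funTS.
- by move=> y Sy; rewrite lee_fin; have /andP[] := L01 Sy jK.
Qed.

(** The halves of the simplex on the side of [p i] and of [p j]. They are separated by the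
    hyperplane [H], which passes through the midpoint of the edge and through the other vertices. *)
Let S1 : set 'rV[R]_n := S `&` [set y | L j y < L i y].
Let S2 : set 'rV[R]_n := S `&` [set y | L i y < L j y].
Let H : set 'rV[R]_n := [set y | affine_form (b i - b j) (c i - c j) y = 0].

Let HE y : H y <-> L i y = L j y.
Proof.
have -> : H y = (L i y - L j y = 0).
  by congr (_ = 0); rewrite /L /affine_form mulmxBr !mxE; ring.
by split=> [/subr0_eq|->]; rewrite ?subrr.
Qed.

Let measurable_coord_lt k l : measurable (S `&` [set y | L k y < L l y]).
Proof.
apply: measurableI => //; rewrite (_ : [set _ | _] = (L l \- L k) @^-1` `]0, +oo[%classic).
  by apply: measurable_preimage; [exact: measurable_funB|exact: measurable_itv].
by apply/seteqP; split => y /=; rewrite in_itv/= andbT subr_gt0.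
Qed.

Let mS1 : measurable S1.
Proof. exact: measurable_coord_lt. Qed.

Let mS2 : measurable S2.
Proof. exact: measurable_coord_lt. Qed.

Let H0 : lambda H = 0%E.
Proof.
(* Equal gradients would make [L i - L j] constant, but it is 1 at [p i] and -1 at [p j]. *)
apply: lebesgue_hyperplane; apply/negP => /eqP bij.
have := L_vertex iK iK; have := L_vertex jK jK.
have := L_vertex iK jK; have := L_vertex jK iK.
rewrite !eqxx (negbTE ij) eq_sym (negbTE ij) /L /affine_form.
by rewrite (subr0_eq bij) /=; lra.
Qed.

Let integral_split F : lambda.-integrable S (EFin \o F) ->
  \int[lambda]_(y in S) F y =
  \int[lambda]_(y in S1) F y + \int[lambda]_(y in S2) F y.
Proof.
move=> iF.
have SH : S `\` H = S1 `|` S2.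
  apply/seteqP; split => y.
    by move=> [Sy /HE]; case: (ltgtP (L i y) (L j y)) => ? // _; [right|left].
  by move=> [[Sy h]|[Sy h]]; split=> // /HE e; move: h; rewrite /= e ltxx.
rewrite {1}/Rintegral (negligible_integral (measurable_hyperplane _ _) mS iF H0) SH.
rewrite -[LHS]/(Rintegral _ _ _) Rintegral_setU//.
  apply: integrableS iF => //; first exact: measurableU.
  by move=> y [[]|[]].
apply/disj_setPS => y [[_ h1] [_ h2]].
by move: h1 h2 => /= h1 h2; have := lt_trans h1 h2; rewrite ltxx.
Qed.

Let tau_S1 : tau @^-1` S1 = S2.
Proof.
apply/seteqP; split => y [].
  by move/tau_S => Sy; rewrite /= !tauL// tpermL tpermR.
by move=> Sy h; split; [exact/tau_S|rewrite /= !tauL// tpermL tpermR].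
Qed.

(* Halving the simplex through the midpoint of the edge ij expresses the
   integral of L_i L_j on one half through those of L_i L_j and L_j^2. *)
Let mid k := if k == j then 2^-1 *: p i + (1 - 2^-1) *: p j else p k.
Let dbl k := if k == j then 2 *: p j + (1 - 2) *: p i else p k.
Let bis := barycentric_map mid.

Let barycentric_map_conv q a u v : barycentric_map q (a *: u + (1 - a) *: v) =
  a *: barycentric_map q u + (1 - a) *: barycentric_map q v.
Proof.
rewrite !barycentric_mapE mulmxDl -!scalemxAl !scalerDr addrACA; congr (_ + _).
by rewrite -scalerDl addrC subrK scale1r.
Qed.

Let dbl_mid k : k \in K -> barycentric_map dbl (mid k) = p k.
Proof.
move=> kK; rewrite /mid; have [->|kj] := eqVneq k j; last first.
  by rewrite barycentric_map_vertex// /dbl (negbTE kj).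
rewrite barycentric_map_conv !barycentric_map_vertex// /dbl (negbTE ij) eqxx.
by apply/rowP => l; rewrite !mxE; field.
Qed.

Let mid_dbl k : k \in K -> barycentric_map mid (dbl k) = p k.
Proof.
move=> kK; rewrite /dbl; have [->|kj] := eqVneq k j; last first.
  by rewrite barycentric_map_vertex// /mid (negbTE kj).
rewrite barycentric_map_conv !barycentric_map_vertex// /mid (negbTE ij) eqxx.
by apply/rowP => l; rewrite !mxE; field.
Qed.

Let L_mid k l : k \in K -> l \in K -> L k (mid l) =
  if l == j then 2^-1 * (i == k)%:R + 2^-1 * (j == k)%:R else (l == k)%:R.
Proof.
move=> kK lK; rewrite /mid; case: ifPn => _; last exact: L_vertex.
rewrite -(L_vertex iK kK) -(L_vertex jK kK) /L /affine_form mulmxDl -!scalemxAl !mxE.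
by field.
Qed.

(** Moving [p j] to the midpoint hands half of the coordinate [L j] over to [L i] and keeps the
    others. *)
Let bisL k y : k \in K -> L k (bis y) =
  if k == j then L j y / 2 else L k y + (k == i)%:R * (L j y / 2).
Proof.
move=> kK; rewrite coord_barycentric_map (bigD1 j)//= L_mid// eqxx.
under eq_bigr => l /andP[lK lj] do rewrite L_mid// (negbTE lj).
have [->|kj] := eqVneq k j.
  rewrite (negbTE ij) big1 ?addr0; first by rewrite /=; field.
  by move=> l /andP[_ /negbTE->]; rewrite mulr0.
rewrite (eq_sym i) (bigD1 k) ?kK//= eqxx big1 ?addr0; first by rewrite /=; field.
by move=> l /andP[_ /negbTE->]; rewrite mulr0.
Qed.

Let bis_S1 : bis @^-1` S1 = S.
Proof.
apply/seteqP; split => y /=.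
  case=> Sy; rewrite /= !bisL// eqxx (negbTE ij) eqxx mul1r => ijy k kK.
  have jy : 0 < L j y by have := Sy j jK; rewrite -/(L j _) bisL// eqxx; lra.
  rewrite -/(L k _); have [->//|kj] := eqVneq k j.
  have [->|ki] := eqVneq k i; first by lra.
  by have := Sy k kK; rewrite -/(L k _) bisL// (negbTE kj) (negbTE ki) mul0r addr0.
move=> Sy; have iy : 0 < L i y := Sy i iK; have jy : 0 < L j y := Sy j jK.
split=> [k kK|]; last by rewrite /= !bisL// eqxx (negbTE ij) eqxx mul1r; lra.
have ky : 0 < L k y := Sy k kK; rewrite -/(L k _) bisL//.
case: ifP => _; first by lra.
by case: (k == i); rewrite /=; lra.
Qed.

(** Let [P] and [Q] be the integrals of [L i * L j] and [L j * L j] over [S]. By symmetry the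
    integral of [L i * L j] over [S1] is [P / 2]. Pulled back along [bis], whose factor is 2, it
    shows that [P] is the integral of [(L i + L j / 2) * (L j / 2)] over [S], so
    [P = P / 2 + Q / 4]. *)
Lemma integral_coord_mul :
  2 * \int[lambda]_(y in S) (L i y * L j y) = \int[lambda]_(y in S) (L j y * L j y).
Proof.
have [tD tf] := tau_invariance.
have S1S : S1 `<=` S by move=> y [].
have S2S : S2 `<=` S by move=> y [].
have i1 : lambda.-integrable S (EFin \o cst 1).
  by apply: (@open_simplex_bounded_integrable _ _ 1) => // y _; rewrite normr1.
have vol2 : volS = fine (lambda S1) + fine (lambda S1).
  have := integral_split i1; rewrite !Rintegral_cst// !mul1r -/volS => ->.
  by congr (_ + fine _); rewrite -tau_S1; exact: tD.
have fin1 : lambda S1 = (fine (lambda S1))%:E.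
  rewrite fineK// ge0_fin_numE//; apply: le_lt_trans (open_simplex_fin cardK L_vertex).
  by apply: le_measure; rewrite ?inE.
have int2 : \int[lambda]_(y in S) (L i y * L j y) =
    \int[lambda]_(y in S1) (L i y * L j y) + \int[lambda]_(y in S1) (L i y * L j y).
  rewrite integral_split; last exact: integrable_coord_mul.
  congr (_ + _); rewrite -tau_S1; congr fine.
  rewrite -[RHS](tf _ (fun y => (L i y * L j y)%:E))//.
  - by apply: eq_integral => y _; rewrite !tauL// tpermL tpermR mulrC.
  - by apply/measurable_EFinP/measurable_funTS; exact: measurable_funM.
  - move=> y /S1S Sy; rewrite lee_fin.
    by have /andP[? _] := L01 Sy jK; have /andP[? _] := L01 Sy iK; exact: mulr_ge0.
have [s sD sf] := barycentric_change_of_variables dbl_mid mid_dbl.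
(* [bis] pulls [S1] back to the whole of [S], which has twice its volume. *)
have s2 : s%:num = 2.
  have := sD S1 mS1; rewrite bis_S1 volSE fin1 -EFinM => -[volE].
  have v1 : fine (lambda S1) != 0 by apply: lt0r_neq0; have := volS_gt0; lra.
  by apply: (mulIf v1); lra.
have mF : measurable_fun S1 (fun y => (L i y * L j y)%:E).
  by apply/measurable_EFinP/measurable_funTS; exact: measurable_funM.
have F0 y : S1 y -> (0 <= (L i y * L j y)%:E)%E.
  move=> /S1S Sy; rewrite lee_fin.
  by have /andP[? _] := L01 Sy jK; have /andP[? _] := L01 Sy iK; exact: mulr_ge0.
have := sf S1 _ mS1 mF F0; rewrite bis_S1 s2.
have -> : (\int[lambda]_(y in S) (L i (bis y) * L j (bis y))%:E)%E =
    (\int[lambda]_(y in S) (2^-1 * (L i y * L j y) + 4^-1 * (L j y * L j y)))%:E.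
  rewrite -RE//; last first.
    apply: (@open_simplex_bounded_integrable _ _ 1) => //.
      apply: measurable_funD; apply: measurable_funM => //; exact: measurable_funM.
    move=> y Sy; have /andP[i0 i1'] := L01 Sy iK; have /andP[j0 j1] := L01 Sy jK.
    by rewrite ger0_norm; nra.
  apply: eq_integral => y _; rewrite !bisL// eqxx (negbTE ij) eqxx mul1r; congr (_%:E).
  by field.
rewrite RE//; last exact: integrable_coord_mul.
rewrite RintegralD//; last 2 first.
- have /(integrableZl mS 2^-1) := integrable_coord_mul mS (@subset_refl _ S) iK jK.
  by apply: eq_integrable.
- have /(integrableZl mS 4^-1) := integrable_coord_mul mS (@subset_refl _ S) jK jK.
  by apply: eq_integrable.
rewrite !RintegralZl//; try exact: integrable_coord_mul.
by rewrite -EFinM => -[]; move: int2; lra.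
Qed.

End transposition.

Let sumL_mul i : i \in K ->
  \int[lambda]_(y in S) L i y = \sum_(j in K) \int[lambda]_(y in S) (L i y * L j y).
Proof.
move=> iK; rewrite -Rintegral_sum//; last by move=> j jK; exact: integrable_coord_mul.
apply: eq_Rintegral => y _.
by rewrite -mulr_sumr (barycentric_sum1 cardK L_vertex) mulr1.
Qed.

(** The [n.+1] coordinates have equal integrals, and they sum to 1. *)
Lemma integral_coord i : i \in K ->
  \int[lambda]_(y in S) L i y = n.+1%:R^-1 * volS.
Proof.
move=> iK; have : \int[lambda]_(y in S) 1 = volS by rewrite Rintegral_cst// mul1r.
have -> : \int[lambda]_(y in S) 1 = \int[lambda]_(y in S) \sum_(k in K) L k y.
  by apply: eq_Rintegral => y _; rewrite (barycentric_sum1 cardK L_vertex).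
rewrite Rintegral_sum//; last by move=> j jK; exact: integrable_coord.
rewrite (eq_bigr (fun=> \int[lambda]_(y in S) L i y)) => [|k kK].
  by rewrite sumr_const cardK => <-; rewrite -[X in _ = _ * X]mulr_natl mulKf.
by have [->//|ki] := eqVneq k i; exact: integral_coord_sym.
Qed.

(** Summing the integrals of [L i * L k] over all [k] gives the integral of [L i]. Each of the [n]
    cross terms is half the square term [B], so [B + n * (B / 2)] equals [volS / (n + 1)]. *)
Lemma integral_coord_sqr i : i \in K ->
  \int[lambda]_(y in S) (L i y * L i y) = 2 * volS / (n.+1%:R * n.+2%:R).
Proof.
move=> iK; have := sumL_mul iK; rewrite integral_coord// (bigD1 i)//=.
pose B := \int[lambda]_(y in S) (L i y * L i y).
rewrite (eq_bigr (fun=> B / 2)) => [|k /andP[kK ki]]; last first.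
  have := integral_coord_mul kK iK ki; rewrite -/B => <-.
  by under eq_Rintegral do rewrite mulrC; rewrite mulrAC divff// mul1r.
rewrite -/B sumr_const.
have -> : #|[pred k | (k \in K) && (k != i)]| = n.
  have := cardK; rewrite (cardD1 i) iK add1n => -[<-].
  by apply: eq_card => k; rewrite !inE andbC.
rewrite -[X in _ = _ + X]mulr_natl => h.
have -> : volS = n.+1%:R * (B + n%:R * (B / 2)) by rewrite -h mulrA divff// mul1r.
have -> : n.+2%:R = n%:R + 2 :> R by rewrite -addn2 natrD.
have -> : n.+1%:R = n%:R + 1 :> R by rewrite -[in LHS]addn1 natrD.
have n0 : 0 <= n%:R :> R by [].
by field; apply/andP; split; apply: lt0r_neq0; lra.
Qed.

Lemma integral_coord_mul_neq i j : i \in K -> j \in K -> i != j ->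
  \int[lambda]_(y in S) (L i y * L j y) = volS / (n.+1%:R * n.+2%:R).
Proof.
move=> iK jK ij; apply: (@mulfI _ 2) => //.
by rewrite integral_coord_mul// integral_coord_sqr// mulrA.
Qed.

End simplex_integrals.

(** * Integrals and null sets *)

Section null_set.
Local Open Scope ereal_scope.
Context d (T : measurableType d) (R : realType) (mu : {measure set T -> \bar R}).
Variables (N : set T).
Hypotheses (mN : measurable N) (N0 : mu N = 0).

Import HBNNSimple.

(* Applied to the gradients of the basis functions, which may take arbitrary
   values on the faces of the elements: hence no measurability assumption.
   Removing a null set from a simple function does not change its integral. *)
Lemma ge0_le_integral_off_null (f g : T -> \bar R) :
  (forall y, 0 <= f y) -> (forall y, 0 <= g y) ->
  (forall y, ~ N y -> f y <= g y) -> \int[mu]_y f y <= \int[mu]_y g y.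
Proof.
move=> f0 g0 fg; rewrite !ge0_integralTE//.
apply: ge_ereal_sup => _ [h /= hf <-].
have mNC : measurable (~` N) by exact: measurableC.
pose h' := proj_nnsfun h mNC.
apply: (@le_trans _ _ (sintegral mu h')).
  rewrite -!integralT_nnsfun (@ge0_negligible_integral _ _ _ mu setT N)//; last 2 first.
  - by apply/measurable_EFinP; exact: measurable_funP.
  - by move=> y _; rewrite lee_fin.
  rewrite setTD [X in X <= _]integral_mkcond.
  rewrite (_ : \int[mu]_x _ = \int[mu]_x (h' x)%:E)//; apply: eq_integral => y _.
  rewrite patchE /h' /= mindicE; case: ifPn => yN; rewrite ?mulr1 ?mulr0//.
apply: ereal_sup_ubound; exists h' => //= y.
rewrite mindicE; have [yN|yN] := boolP (y \in ~` N); last by rewrite mulr0.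
rewrite mulr1; apply: le_trans (hf y) _; apply: fg.
by move: yN; rewrite inE.
Qed.

Lemma eq_integral_off_null (f g : T -> \bar R) :
  (forall y, ~ N y -> f y = g y) -> \int[mu]_y f y = \int[mu]_y g y.
Proof.
move=> fg; rewrite integralE [RHS]integralE.
have pos := @funepos_ge0 T R; have neg := @funeneg_ge0 T R.
congr (_ - _); apply/le_anti/andP; split; apply: ge0_le_integral_off_null => // y Ny;
  by rewrite ?funeposE ?funenegE fg.
Qed.

(** Comparing restrictions lets the domain change along with the integrand, as when [Omega] or a
    hull is replaced by open simplices. *)
Lemma eq_Rintegral_off_null (D E : set T) (f g : T -> R) :
  (forall y, ~ N y -> (f \_ D) y = (g \_ E) y) ->
  (\int[mu]_(y in D) f y = \int[mu]_(y in E) g y)%R.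
Proof.
move=> fg; rewrite Rintegral_mkcond [RHS]Rintegral_mkcond; congr fine.
by apply: eq_integral_off_null => y Ny; rewrite fg.
Qed.

End null_set.

(** * Triangulations *)

Section mesh.
Variables (R : realType) (d Nv : nat).
Variables (Omega : set 'rV[R]_d) (x : 'I_Nv -> 'rV[R]_d) (Th : {set {set 'I_Nv}}).
Variables (Nvi : nat) (phi : 'I_Nv -> 'rV[R]_d -> R).
Hypothesis d_gt0 : (0 < d)%N.
Hypotheses (hTh : triangulation Omega x Th Nvi) (hphi : P1_basis Omega x Th phi).
Local Notation lambda := (lebesgue_rV R d).

Lemma P1_coefficients : exists (b : {set 'I_Nv} -> 'I_Nv -> 'cV[R]_d)
    (c : {set 'I_Nv} -> 'I_Nv -> R), forall K, K \in Th ->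
  forall j y, hull x K y -> phi j y = affine_form (b K j) (c K j) y.
Proof.
have /choice[p pP] : forall Kj : {set 'I_Nv} * 'I_Nv, exists q : 'cV[R]_d * R,
    Kj.1 \in Th -> forall y, hull x Kj.1 y -> phi Kj.2 y = affine_form q.1 q.2 y.
  (* Sets outside the triangulation get the default coefficients 0. *)
  move=> [K j] /=; have [KTh|KTh] := boolP (K \in Th); last by exists (0, 0).
  by have [b [c bc]] := P1_linear hphi j KTh; exists (b, c).
exists (fun K j => (p (K, j)).1), (fun K j => (p (K, j)).2) => K KTh j y.
exact: (pP (K, j)).
Qed.

Variables (b : {set 'I_Nv} -> 'I_Nv -> 'cV[R]_d) (c : {set 'I_Nv} -> 'I_Nv -> R).
Hypothesis phiE : forall K, K \in Th ->
  forall j y, hull x K y -> phi j y = affine_form (b K j) (c K j) y.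

Local Notation S K := (open_simplex K (b K) (c K)).

Let cardK K : K \in Th -> #|K| = d.+1.
Proof. by case/(mesh_simplex hTh). Qed.

Lemma vertex_hull (K : {set 'I_Nv}) i : i \in K -> hull x K (x i).
Proof.
move=> iK; exists (fun k => (k == i)%:R); split=> //.
  rewrite (bigD1 i)//= eqxx big1 ?addr0// => k /andP[_ /negbTE->]//.
rewrite (bigD1 i)//= eqxx scale1r big1 ?addr0// => k /andP[_ /negbTE->].
by rewrite scale0r.
Qed.

Lemma coord_vertex K i j : K \in Th -> i \in K ->
  affine_form (b K j) (c K j) (x i) = (i == j)%:R.
Proof.
by move=> KTh iK; rewrite -(phiE KTh)// ?(P1_nodal hphi)//; exact: vertex_hull.
Qed.

Let L_vertex K : K \in Th -> forall i j, i \in K -> j \in K ->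
  affine_form (b K j) (c K j) (x i) = (i == j)%:R.
Proof. by move=> KTh i j iK _; exact: coord_vertex. Qed.

(** An affine form that vanishes at all vertices of a simplex vanishes everywhere. *)
Lemma coord_out K j : K \in Th -> j \notin K -> b K j = 0 /\ c K j = 0.
Proof.
move=> KTh jK; apply: affine_form_inj => y.
rewrite -(barycentric_comb (cardK KTh) (L_vertex KTh) y) affine_form_sum; last first.
  exact: (barycentric_sum1 (cardK KTh) (L_vertex KTh)).
rewrite [RHS](_ : _ = 0); last by rewrite /affine_form mulmx0 !mxE addr0.
rewrite big1// => l lK; rewrite coord_vertex// (_ : l == j = false) ?mulr0//.
by apply: contraNF jK => /eqP <-.
Qed.

Lemma hullE K : K \in Th ->
  hull x K = [set y | forall k, k \in K -> 0 <= affine_form (b K k) (c K k) y].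
Proof. by move=> KTh; rewrite (hull_barycentric (cardK KTh) (L_vertex KTh)). Qed.

Lemma open_simplex_hull K : K \in Th -> S K `<=` hull x K.
Proof. by move=> KTh y Sy; rewrite hullE// => k kK; exact/ltW/Sy. Qed.

(** The open simplex lies in the interior of the hull, where [mesh_interior] applies. *)
Lemma open_simplex_Omega K : K \in Th -> S K `<=` Omega.
Proof.
move=> KTh y Sy; apply: (mesh_interior hTh KTh).
by apply: filterS (open_simplex_nbhs Sy); exact: open_simplex_hull.
Qed.

(** By conformity a common point lies in the hull of the shared vertices. There the coordinate of a
    vertex of [K] outside [K'] would be 0, yet it is positive; so [K] is contained in [K'], and the
    cardinalities agree. *)
Lemma open_simplex_disjoint K K' y : K \in Th -> K' \in Th -> S K y -> S K' y -> K = K'.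
Proof.
move=> KTh K'Th Sy S'y.
have : hull x (K :&: K')%SET y.
  by rewrite -(mesh_conforming hTh)//; split; apply: open_simplex_hull.
move=> [a [a0 a1 ya]].
suff KK' : K \subset K'.
  by apply/eqP; rewrite eqEcard KK' (cardK KTh) (cardK K'Th)/=.
apply/fintype.subsetP => k kK; apply: contraPT (Sy k kK) => kK'.
rewrite ya affine_form_sum// big1 ?ltxx// => l /[!inE]/andP[lK lK'].
rewrite coord_vertex// (_ : l == k = false) ?mulr0//.
by apply: contraNF kK' => /eqP <-.
Qed.

(** The full hyperplanes carrying the faces rather than the faces alone: still a null set, and
    plainly measurable. *)
Definition skeleton : set 'rV[R]_d := \bigcup_(q in [set q : {set 'I_Nv} * 'I_Nv |
  (q.1 \in Th) && (q.2 \in q.1)]) [set y | affine_form (b q.1 q.2) (c q.1 q.2) y = 0].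

Lemma measurable_skeleton : measurable skeleton.
Proof.
apply: fin_bigcup_measurable; first exact: finite_finset.
by move=> q _; exact: measurable_hyperplane.
Qed.

Lemma coord_gradient_neq0 K k : K \in Th -> k \in K -> b K k != 0.
Proof.
move=> KTh kK; apply/eqP => b0.
(* Since [d > 0] there is a second vertex, at which the coordinate of [k] is 0 instead of 1. *)
have [l] : exists l, l \in K :\ k.
  apply/set0Pn; rewrite -card_gt0; have := cardK KTh.
  by rewrite (cardsD1 k) kK add1n => -[->].
rewrite !inE => /andP[/negbTE lk lK].
have := coord_vertex k KTh lK; have := coord_vertex k KTh kK.
by rewrite b0 /affine_form !mulmx0 !mxE eqxx lk => -> /eqP; rewrite oner_eq0.
Qed.

Lemma lebesgue_skeleton : lambda skeleton = 0%E.
Proof.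
apply/eqP; rewrite eq_le measure_ge0 andbT.
pose Q := [set q : {set 'I_Nv} * 'I_Nv | (q.1 \in Th) && (q.2 \in q.1)].
pose H (q : {set 'I_Nv} * 'I_Nv) := [set y | affine_form (b q.1 q.2) (c q.1 q.2) y = 0].
have <- : (\sum_(q \in Q) lambda (H q) = 0)%E.
  apply: fsbig1 => q /= /andP[qTh q2].
  by apply: lebesgue_hyperplane; exact: coord_gradient_neq0.
apply: content_sub_fsum => //; first exact: finite_finset.
- by move=> q _; exact: measurable_hyperplane.
- exact: measurable_skeleton.
Qed.

Lemma Omega_skeleton y : Omega y -> ~ skeleton y -> exists2 K, K \in Th & S K y.
Proof.
move=> /subset_closure; rewrite (mesh_cover hTh) => -[K /= KTh]; rewrite hullE// => hy ny.
exists K => // k kK; rewrite lt_neqAle hy// andbT eq_sym; apply/eqP => e.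
by apply: ny; exists (K, k) => //=; rewrite KTh.
Qed.

Lemma hull_skeleton K y : K \in Th -> hull x K y -> ~ skeleton y -> S K y.
Proof.
move=> KTh; rewrite hullE// => hy ny k kK.
rewrite lt_neqAle hy// andbT eq_sym; apply/eqP => e.
by apply: ny; exists (K, k) => //=; rewrite KTh.
Qed.

(** Off the skeleton, a point of [Omega] lies in exactly one open simplex and a point outside
    [Omega] in none, so the restriction of [F] to [Omega] is the sum of its restrictions to the open
    simplices. *)
Lemma Rintegral_Omega (F : 'rV[R]_d -> R) :
  (forall K, K \in Th -> lambda.-integrable (S K) (EFin \o F)) ->
  \int[lambda]_(y in Omega) F y = \sum_(K in Th) \int[lambda]_(y in S K) F y.
Proof.
move=> iF; under [RHS]eq_bigr do rewrite Rintegral_mkcond.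
rewrite -Rintegral_sum//; last first.
  move=> K KTh; rewrite -restrict_EFin.
  have mS := measurable_open_simplex K (b K) (c K).
  by have /(integrable_mkcond _ mS) := iF K KTh.
apply: (eq_Rintegral_off_null measurable_skeleton lebesgue_skeleton) => y ny.
rewrite patch_setT patchE; case: ifPn => [|yO].
  rewrite inE => /Omega_skeleton-/(_ ny)[K KTh Sy].
  rewrite (bigD1 K)//= patchE mem_set// big1 ?addr0// => K' /andP[K'Th K'K].
  rewrite patchE; case: ifPn => //; rewrite inE => S'y.
  by move: K'K; rewrite (open_simplex_disjoint K'Th KTh S'y Sy) eqxx.
rewrite big1// => K KTh; rewrite patchE; case: ifPn => //; rewrite inE => Sy.
by move: yO; rewrite notin_setE; case; exact: (open_simplex_Omega KTh).
Qed.

End mesh.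

(** * Entries of the mass and stiffness matrices *)

Lemma derive_affine_form (R : realType) n (b : 'cV[R]_n) c (v y : 'rV[R]_n) :
  'D_v (affine_form b c) y = (v *m b) 0 0.
Proof.
rewrite /derive; apply: cvg_lim => //; apply: cvg_near_cst; near=> h.
have h0 : h != 0 by near: h; exact: nbhs_dnbhs_neq.
have hvb : ((h *: v + y) *m b) 0 0 = h * (v *m b) 0 0 + (y *m b) 0 0.
  by rewrite mulmxDl -scalemxAl [LHS]mxE; congr (_ + _); rewrite [LHS]mxE.
rewrite /= /affine_form hvb -[LHS]/(h^-1 * _).
by rewrite opprD addrACA subrr addr0 addrK mulKf.
Unshelve. all: by end_near. Qed.

Lemma bform_sum (R : realType) n (B : 'M[R]_n) (u v : 'cV[R]_n) :
  bform B u v = \sum_k \sum_l u k 0 * v l 0 * B k l.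
Proof.
rewrite /bform mxE exchange_big; apply: eq_bigr => l _; rewrite mxE mulr_suml.
by apply: eq_bigr => k _; rewrite mxE; ring.
Qed.

Section entries.
Variables (R : realType) (d Nv : nat).
Variables (Omega : set 'rV[R]_d) (x : 'I_Nv -> 'rV[R]_d) (Th : {set {set 'I_Nv}}).
Variables (Nvi : nat) (phi : 'I_Nv -> 'rV[R]_d -> R).
Hypotheses (d_gt0 : (0 < d)%N) (oOmega : open Omega).
Hypotheses (hTh : triangulation Omega x Th Nvi) (hphi : P1_basis Omega x Th phi).
Variables (b : {set 'I_Nv} -> 'I_Nv -> 'cV[R]_d) (c : {set 'I_Nv} -> 'I_Nv -> R).
Hypothesis phiE : forall K, K \in Th ->
  forall j y, hull x K y -> phi j y = affine_form (b K j) (c K j) y.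
Local Notation lambda := (lebesgue_rV R d).
Local Notation S K := (open_simplex K (b K) (c K)).
Local Notation L K j := (affine_form (b K j) (c K j)).

Let cardK K : K \in Th -> #|K| = d.+1.
Proof. by case/(mesh_simplex hTh). Qed.

Let L_vertex K : K \in Th -> forall i j, i \in K -> j \in K -> L K j (x i) = (i == j)%:R.
Proof. by move=> KTh i j iK _; exact: (coord_vertex hphi phiE). Qed.

Let mS K : measurable (S K).
Proof. exact: measurable_open_simplex. Qed.

Let phiS K j y : K \in Th -> S K y -> phi j y = L K j y.
Proof. by move=> KTh Sy; apply: phiE => //; exact: (open_simplex_hull hTh hphi phiE). Qed.

Lemma P1_out K j y : K \in Th -> j \notin K -> hull x K y -> phi j y = 0.
Proof.
move=> KTh jK Ky; rewrite (phiE KTh)//.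
have [-> ->] := coord_out hTh hphi phiE KTh jK.
by rewrite /affine_form mulmx0 mxE addr0.
Qed.

Lemma P1_01 j y : closure Omega y -> 0 <= phi j y <= 1.
Proof.
rewrite (mesh_cover hTh) => -[K /= KTh Ky].
have [jK|jK] := boolP (j \in K); last by rewrite (P1_out KTh jK Ky) lexx ler01.
rewrite (phiE KTh)//; move: Ky; rewrite (hullE hTh hphi phiE)//= => Ky.
rewrite Ky//= -(barycentric_sum1 (cardK KTh) (L_vertex KTh) y) (bigD1 j)//= lerDl.
by apply: sumr_ge0 => l /andP[lK _]; exact: Ky.
Qed.

Let S_Omega K : K \in Th -> S K `<=` Omega.
Proof. exact: (open_simplex_Omega hTh hphi phiE). Qed.

Let S_closure K : K \in Th -> S K `<=` closure Omega.
Proof. by move=> KTh y /(S_Omega KTh)/subset_closure. Qed.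

Let vol K := volume (hull x K).

Lemma measurable_hull K : K \in Th -> measurable (hull x K).
Proof.
move=> KTh; rewrite (hullE hTh hphi phiE)//.
rewrite (_ : [set _ | _] = \bigcap_(k in [set k | k \in K]) (L K k @^-1` `[0, +oo[%classic)).
  apply: fin_bigcap_measurable; first exact: finite_finset.
  move=> k _; apply: measurable_preimage; last exact: measurable_itv.
  exact: measurable_affine_form.
apply/seteqP; split => y /= h k kK; have := h k kK; first by rewrite /= in_itv/= andbT.
by rewrite /= in_itv/= andbT.
Qed.

(** Applied with [E] equal to [Omega] for the averages of [D], and to the whole space for
    volumes. *)
Lemma Rintegral_hull K (E : set 'rV[R]_d) F : K \in Th -> S K `<=` E ->
  \int[lambda]_(y in hull x K `&` E) F y = \int[lambda]_(y in S K) F y.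
Proof.
move=> KTh SE; apply: (eq_Rintegral_off_null (measurable_skeleton Th b c)).
  exact: (lebesgue_skeleton d_gt0 hTh hphi phiE).
move=> y ny; rewrite !patchE; case: ifPn => [|hy].
  rewrite inE => -[hy _]; rewrite mem_set//.
  exact: (hull_skeleton hTh hphi phiE).
case: ifPn => //; rewrite inE => Sy; move: hy; rewrite notin_setE; case.
by split; [exact: (open_simplex_hull hTh hphi phiE)|exact: SE].
Qed.

Lemma volumeE K : K \in Th -> vol K = fine (lambda (S K)).
Proof.
move=> KTh; have := @Rintegral_hull K setT (fun=> 1) KTh (@subsetT _ _).
by rewrite setIT !Rintegral_cst ?mul1r//; exact: measurable_hull.
Qed.

Lemma volume_gt0 K : K \in Th -> 0 < vol K.
Proof.
move=> KTh; rewrite volumeE// -lte_fin fineK.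
  exact: (open_simplex_gt0 (cardK KTh) (L_vertex KTh)).
by rewrite ge0_fin_numE// (open_simplex_fin (cardK KTh) (L_vertex KTh)).
Qed.

(** The basis functions are determined only on the closure of [Omega], so measurability is taken
    from a function [G] that agrees with [F] on the element. *)
Lemma P1_bounded_integrable K (F G : 'rV[R]_d -> R) M : K \in Th ->
  measurable_fun setT G -> (forall y, S K y -> F y = G y) ->
  (forall y, S K y -> `|F y| <= M) -> lambda.-integrable (S K) (EFin \o F).
Proof.
move=> KTh mG FG FM; apply: (@eq_integrable _ _ _ _ _ (mS K) (EFin \o G)).
  by move=> y; rewrite inE => Sy /=; rewrite FG.
apply: (open_simplex_bounded_integrable (cardK KTh) (L_vertex KTh)) => // y Sy.
by rewrite -FG//; exact: FM.
Qed.

Let mL K j : measurable_fun setT (L K j).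
Proof. exact: measurable_affine_form. Qed.

Lemma mass_integrable K i j : K \in Th ->
  lambda.-integrable (S K) (EFin \o fun y => phi j y * phi i y).
Proof.
move=> KTh; apply: (@P1_bounded_integrable K _ (fun y => L K j y * L K i y) 1) => //.
- exact: measurable_funM.
- by move=> y Sy; rewrite !(phiS _ KTh Sy).
- move=> y /(S_closure KTh) Oy.
  have /andP[i0 i1] := P1_01 i Oy; have /andP[j0 j1] := P1_01 j Oy.
  by rewrite ger0_norm ?mulr_ge0// mulr_ile1.
Qed.

(** On each element the two basis functions are barycentric coordinates, or 0 when the vertex is not
    in the element. *)
Lemma mass_entry i j :
  \int[lambda]_(y in Omega) (phi j y * phi i y) =
  \sum_(K in Th | (i \in K) && (j \in K))
    vol K * (1 + (i == j)%:R) / (d.+1%:R * d.+2%:R).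
Proof.
rewrite (Rintegral_Omega d_gt0 hTh hphi phiE); last by move=> K; exact: mass_integrable.
rewrite [RHS]big_mkcondr/=; apply: eq_bigr => K KTh.
rewrite (@eq_Rintegral _ _ _ _ _ (fun y => L K j y * L K i y)); last first.
  by move=> y; rewrite inE => Sy; rewrite !(phiS _ KTh Sy).
have out k : k \notin K -> forall y, L K k y = 0.
  move=> kK y; have [-> ->] := coord_out hTh hphi phiE KTh kK.
  by rewrite /affine_form mulmx0 mxE addr0.
have [iK|iK] := boolP (i \in K); last first.
  rewrite (@eq_Rintegral _ _ _ _ _ (fun=> 0)) ?Rintegral_cst ?mul0r//.
  by move=> y _; rewrite (out i)// mulr0.
have [jK|jK] := boolP (j \in K); last first.
  rewrite (@eq_Rintegral _ _ _ _ _ (fun=> 0)) ?Rintegral_cst ?mul0r//.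
  by move=> y _; rewrite (out j)// mul0r.
rewrite volumeE//=; have [<-|ij] := eqVneq i j.
  by rewrite (integral_coord_sqr (cardK KTh) (L_vertex KTh))//= (mulrC 2).
rewrite (integral_coord_mul_neq (cardK KTh) (L_vertex KTh))// 1?eq_sym//.
by rewrite addr0 mulr1.
Qed.

Lemma grad_P1 K i y : K \in Th -> S K y -> grad (phi i) y = b K i.
Proof.
move=> KTh Sy; apply/colP => k; rewrite mxE.
rewrite (@near_eq_derive _ _ _ _ (L K i)); last first.
  apply: filterS (open_simplex_nbhs Sy) => z Sz; exact: phiS.
by rewrite derive_affine_form -rowE mxE.
Qed.

Lemma elt_gradE K i : K \in Th -> elt_grad x phi K i = b K i.
Proof.
move=> KTh; apply: grad_P1 => //; rewrite /centroid (cardK KTh).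
exact: (barycenter_open_simplex (cardK KTh) (L_vertex KTh)).
Qed.

Variable D : 'rV[R]_d -> 'M[R]_d.
Hypothesis hD : diffusion_tensor Omega D.

Let D_integrable K k l : K \in Th ->
  lambda.-integrable (S K) (EFin \o fun y => D y k l).
Proof.
move=> KTh; apply: integrableS (tensor_integrable hD k l) => //.
  exact: open_measurable_rV.
exact: S_Omega.
Qed.

(** The gradients are constant on each open simplex, so only the entries of [D] stay under the
    integral; the factor [vol K] undoes the normalisation in [elt_avg]. *)
Lemma stiffness_entry i j :
  \int[lambda]_(y in Omega) bform (D y) (grad (phi i) y) (grad (phi j) y) =
  \sum_(K in Th) vol K * bform (elt_avg Omega x D K) (elt_grad x phi K i) (elt_grad x phi K j).
Proof.
have intZ K (k l : 'I_d) : K \in Th -> lambda.-integrable (S K)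
    (EFin \o fun y => b K i k 0 * b K j l 0 * D y k l).
  move=> KTh; have /(integrableZl (mS K) (b K i k 0 * b K j l 0)) := D_integrable k l KTh.
  exact: eq_integrable.
have bE K y : K \in Th -> S K y -> bform (D y) (grad (phi i) y) (grad (phi j) y) =
    \sum_k \sum_l b K i k 0 * b K j l 0 * D y k l.
  by move=> KTh Sy; rewrite !(grad_P1 _ KTh Sy) bform_sum.
have intS K k : K \in Th -> lambda.-integrable (S K)
    (EFin \o fun y => \sum_l b K i k 0 * b K j l 0 * D y k l).
  by move=> KTh; apply: integrable_Rsum => // l _; exact: intZ.
rewrite (Rintegral_Omega d_gt0 hTh hphi phiE) => [|K KTh]; last first.
  apply: (@eq_integrable _ _ _ _ _ (mS K)
    (EFin \o fun y => \sum_k \sum_l b K i k 0 * b K j l 0 * D y k l)).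
    by move=> y; rewrite inE => Sy /=; rewrite (bE K).
  by apply: integrable_Rsum => // k _; exact: intS.
apply: eq_bigr => K KTh; rewrite !elt_gradE//.
rewrite (@eq_Rintegral _ _ _ _ _
  (fun y => \sum_k \sum_l b K i k 0 * b K j l 0 * D y k l)); last first.
  by move=> y; rewrite inE => Sy; rewrite (bE K).
rewrite Rintegral_sum//; last by move=> k _; exact: intS.
rewrite bform_sum mulr_sumr; apply: eq_bigr => k _.
rewrite Rintegral_sum//; last by move=> l _; exact: intZ.
rewrite mulr_sumr; apply: eq_bigr => l _.
rewrite RintegralZl//; last exact: D_integrable.
rewrite /elt_avg !mxE Rintegral_hull//; last exact: S_Omega.
rewrite -/(vol K) mulrCA mulVKf//; exact/lt0r_neq0/volume_gt0.
Qed.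

(** The coordinates on an element sum to the constant 1, whose gradient is 0. *)
Lemma coord_gradient_sum K : K \in Th -> \sum_j b K j = 0.
Proof.
move=> KTh; have sumb : \sum_j b K j = \sum_(j in K) b K j.
  rewrite [RHS]big_mkcond/=; apply: eq_bigr => j _; case: ifPn => // jK.
  by have [] := coord_out hTh hphi phiE KTh jK.
rewrite sumb.
suff e y : affine_form (\sum_(j in K) b K j) (\sum_(j in K) c K j) y = affine_form 0 1 y.
  by have [] := affine_form_inj e.
 rewrite [RHS]/affine_form mulmx0 mxE add0r.
rewrite -(barycentric_sum1 (cardK KTh) (L_vertex KTh) y) /affine_form.
by rewrite mulmx_sumr summxE -big_split.
Qed.

Lemma stiffness_row_sum i : \sum_j
  \int[lambda]_(y in Omega) bform (D y) (grad (phi i) y) (grad (phi j) y) = 0.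
Proof.
under eq_bigr do rewrite stiffness_entry.
rewrite exchange_big big1//= => K KTh; rewrite -mulr_sumr.
rewrite (_ : \sum_j _ = bform (elt_avg Omega x D K) (elt_grad x phi K i) 0).
  by rewrite /bform mulmx0 mxE mulr0.
rewrite -(coord_gradient_sum KTh) /bform mulmx_sumr summxE.
by apply: eq_bigr => j _; rewrite !elt_gradE.
Qed.

(** All mass integrals are nonnegative, and the diagonal one is positive because every vertex
    belongs to some element. *)
Lemma mass_row_sum_gt0 i : 0 < \sum_j \int[lambda]_(y in Omega) (phi j y * phi i y).
Proof.
have den : 0 < d.+1%:R * d.+2%:R :> R by rewrite mulr_gt0.
have ge0 j : 0 <= \int[lambda]_(y in Omega) (phi j y * phi i y).
  rewrite mass_entry sumr_ge0// => K /andP[KTh _].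
  by rewrite !mulr_ge0 ?invr_ge0 ?(ltW den) ?addr_ge0 ?(ltW (volume_gt0 KTh)).
rewrite (bigD1 i)//= ltr_pwDl// ?sumr_ge0// mass_entry.
have [K KTh iK] := mesh_vertex hTh i.
rewrite (bigD1 K)/=; last by rewrite KTh iK.
have pos K' : K' \in Th ->
    0 < vol K' * (1 + (i == i)%:R) / (d.+1%:R * d.+2%:R).
  by move=> K'Th; rewrite divr_gt0// mulr_gt0 ?volume_gt0// eqxx.
by rewrite ltr_pwDl ?pos// sumr_ge0// => K' /andP[/andP[K'Th _] _]; exact/ltW/pos.
Qed.

End entries.

(** * The explicit-reaction scheme *)

Lemma discrete_minimum_principle (R : realFieldType) N (I : pred 'I_N) (B : 'M[R]_N)
    (w : 'cV[R]_N) :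
  (forall i, ~~ I i -> 0 <= w i 0) ->
  (forall i j, I i -> i != j -> B i j <= 0) ->
  (forall i, I i -> 0 < \sum_j B i j) ->
  (forall i, I i -> 0 <= (B *m w) i 0) -> forall i, 0 <= w i 0.
Proof.
move=> wb Boff Brow Bw i0; rewrite leNgt; apply/negP => wi0.
case: (@Order.TotalTheory.arg_minP _ _ _ i0 xpredT (fun i => w i 0)) => // i _ wi.
have {wi0 i0} wi0 : w i 0 < 0 by apply: le_lt_trans wi0; exact: wi.
have Ii : I i by apply/negPn/negP => /wb; rewrite leNgt wi0.
have := Bw i Ii; rewrite mxE leNgt => /negP; apply.
(* As [w i 0] is the minimum, no term of the first sum is positive (the diagonal one is 0); the
   positive row sum times [w i 0 < 0] makes the total negative. *)
have -> : \sum_j B i j * w j 0 = \sum_j B i j * (w j 0 - w i 0) + (\sum_j B i j) * w i 0.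
  by rewrite mulr_suml -big_split/=; apply: eq_bigr => j _; ring.
rewrite -[X in _ < X]addr0 ler_ltD//; last by rewrite pmulr_rlt0// Brow.
apply: sumr_le0 => j _; have [->|ij] := eqVneq j i; first by rewrite subrr mulr0.
by rewrite mulr_le0_ge0 ?subr_ge0 ?wi// Boff// eq_sym.
Qed.

Section step.
Variables (R : realType) (d Nv : nat).
Variables (Omega : set 'rV[R]_d) (x : 'I_Nv -> 'rV[R]_d) (Th : {set {set 'I_Nv}}).
Variables (Nvi : nat) (phi : 'I_Nv -> 'rV[R]_d -> R).
Hypotheses (d_gt0 : (0 < d)%N) (oOmega : open Omega).
Hypotheses (hTh : triangulation Omega x Th Nvi) (hphi : P1_basis Omega x Th phi).
Local Notation lambda := (lebesgue_rV R d).

Lemma fe_fun_bound (w : 'cV[R]_Nv) y : closure Omega y ->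
  `|fe_fun phi w y| <= \sum_j `|w j 0|.
Proof.
move=> Oy; apply: le_trans (ler_norm_sum _ _ _) _; apply: ler_sum => j _.
have [b [c phiE]] := P1_coefficients hphi.
have /andP[p0 p1] := P1_01 hTh hphi phiE j Oy.
by rewrite normrM ler_piMr// ger0_norm.
Qed.

Variables (f : R -> R) (w : 'cV[R]_Nv).
Hypothesis hf : reaction_term f.

(** Makes the set under the supremum in [max_fneg] bounded, and the reaction integrands
    integrable. *)
Lemma reaction_bound : exists C, forall y, closure Omega y -> `|f (fe_fun phi w y)| <= C.
Proof.
have [C fC] := reaction_bounded hf (\sum_j `|w j 0|).
by exists C => y Oy; have [] := fC _ (fe_fun_bound w Oy).
Qed.

Lemma max_fneg_ge y : closure Omega y -> - max_fneg Omega phi f w <= f (fe_fun phi w y).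
Proof.
move=> Oy; have [C fC] := reaction_bound.
have : `|Num.min (f (fe_fun phi w y)) 0| <= max_fneg Omega phi f w.
  apply: ub_le_sup; last by exists y.
  exists C => _ [z Oz <-]; apply: le_trans (fC z Oz).
  by rewrite minEle; case: ifP => // _; rewrite normr0.
rewrite minEle; have [f0|f0] := leP (f (fe_fun phi w y)) 0.
  by rewrite ler_norml => /andP[].
by rewrite normr0; lra.
Qed.

Lemma reaction_time_step dt y : closure Omega y -> 0 <= dt ->
  (dt%:E <= efrac 1 (max_fneg Omega phi f w))%E -> 0 <= 1 + dt * f (fe_fun phi w y).
Proof.
move=> Oy dt0; rewrite /efrac; have := max_fneg_ge Oy.
(* When the maximum is 0 there is no upper bound on [dt], but then [f] is nonnegative along
   [u_h]. *)
case: ifPn => [/eqP->|m0] fm; first by move=> _; rewrite addr_ge0// mulr_ge0//; lra.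
rewrite lee_fin => dtm.
have [f0|f0] := leP 0 (f (fe_fun phi w y)); first by rewrite addr_ge0// mulr_ge0.
have m_gt0 : 0 < max_fneg Omega phi f w by lra.
move: dtm; rewrite ler_pdivlMr// => dtm.
by have := ler_wpM2l dt0 fm; lra.
Qed.

(** The two integrals combine into that of [(1 + dt * f (u_h)) * phi j * phi i], whose factors are
    all nonnegative. *)
Lemma mass_reaction_ge0 dt i j : 0 <= dt ->
  (dt%:E <= efrac 1 (max_fneg Omega phi f w))%E ->
  0 <= \int[lambda]_(y in Omega) (phi j y * phi i y) +
    dt * \int[lambda]_(y in Omega) (f (fe_fun phi w y) * phi j y * phi i y).
Proof.
move=> dt0 dtm; have [b [c phiE]] := P1_coefficients hphi.
pose S K := open_simplex K (b K) (c K).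
have S_closure K : K \in Th -> S K `<=` closure Omega.
  by move=> KTh y /(open_simplex_Omega hTh hphi phiE KTh)/subset_closure.
have phiS K k y : K \in Th -> S K y -> phi k y = affine_form (b K k) (c K k) y.
  by move=> KTh Sy; apply: (phiE) => //; exact: (open_simplex_hull hTh hphi phiE).
have mfun K k : measurable_fun setT (affine_form (b K k) (c K k)).
  exact: measurable_affine_form.
have [C fC] := reaction_bound.
have intF K : K \in Th -> lambda.-integrable (S K)
    (EFin \o fun y => f (fe_fun phi w y) * phi j y * phi i y).
  move=> KTh; apply: (P1_bounded_integrable hTh hphi phiE (M := C)
    (G := fun y => f (\sum_k w k 0 * affine_form (b K k) (c K k) y)
            * affine_form (b K j) (c K j) y * affine_form (b K i) (c K i) y)) => //.
  - apply: measurable_funM => //; apply: measurable_funM => //.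
    apply: measurableT_comp.
      exact: continuous_measurable_fun (reaction_continuous hf).
    by apply: measurable_sum => k; exact: measurable_funM.
  - move=> y Sy; rewrite !(phiS K _ y KTh Sy); congr (f _ * _ * _).
    by apply: eq_bigr => k _; rewrite (phiS K _ y KTh Sy).
  - move=> y /(S_closure K KTh) Oy; rewrite -mulrA normrM.
    have /andP[i0 i1] := P1_01 hTh hphi phiE i Oy.
    have /andP[j0 j1] := P1_01 hTh hphi phiE j Oy.
    apply: le_trans (fC y Oy); rewrite ler_piMr// ger0_norm ?mulr_ge0//.
    by rewrite mulr_ile1.
have intM K (KTh : K \in Th) := mass_integrable hTh hphi phiE i j KTh.
rewrite !(Rintegral_Omega d_gt0 hTh hphi phiE)// mulr_sumr -big_split/=.
apply: sumr_ge0 => K KTh.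
have mS := measurable_open_simplex K (b K) (c K).
rewrite -RintegralZl//; last exact: intF.
rewrite -RintegralD//; last 2 first.
- exact: intM.
- by apply: (eq_integrable mS _ _ _ (integrableZl mS dt (intF K KTh))).
apply: Rintegral_ge0 => y /(S_closure K KTh) Oy.
have /andP[i0 _] := P1_01 hTh hphi phiE i Oy.
have /andP[j0 _] := P1_01 hTh hphi phiE j Oy.
have := reaction_time_step Oy dt0 dtm; set v := f _ => v0.
rewrite (_ : _ + _ = (1 + dt * v) * (phi j y * phi i y)); last by ring.
by rewrite mulr_ge0// mulr_ge0.
Qed.

Variable D : 'rV[R]_d -> 'M[R]_d.
Hypothesis hD : diffusion_tensor Omega D.

Lemma acute_elt K i j : K \in Th -> i \in K -> j \in K -> i != j ->
  D_acute Omega x Th phi D <= mesh_scale Omega Th *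
    - bform (elt_avg Omega x D K) (elt_grad x phi K i) (elt_grad x phi K j).
Proof.
move=> KTh iK jK ij; apply: ler_wpM2l; first exact: powR_ge0.
apply: ge_inf; last by exists K; split=> //; exists i, j.
pose B K i j := bform (elt_avg Omega x D K) (elt_grad x phi K i) (elt_grad x phi K j).
(* [ge_inf] asks for a lower bound of the set: minus the sum of all absolute values is one. *)
exists (- \sum_K \sum_i \sum_j `|B K i j|) => _ [K' [K'Th [i' [j' [_ _ _ ->]]]]].
rewrite lerN2; apply: le_trans (ler_norm _) _; rewrite -/(B K' i' j').
rewrite (bigD1 K')//= -[leLHS]addr0 lerD//; last first.
  by rewrite sumr_ge0// => *; rewrite sumr_ge0// => *; rewrite sumr_ge0.
rewrite (bigD1 i')//= -[leLHS]addr0 lerD//; last first.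
  by rewrite sumr_ge0// => *; rewrite sumr_ge0.
by rewrite (bigD1 j')//= lerDl sumr_ge0.
Qed.

Lemma mass_stiffness_le0 dt i j : 0 <= D_acute Omega x Th phi D ->
  (efrac (mesh_scale Omega Th)
     ((d%:R + 1) * (d%:R + 2) * D_acute Omega x Th phi D) <= dt%:E)%E -> 0 < dt ->
  i != j ->
  \int[lambda]_(y in Omega) (phi j y * phi i y) +
  dt * \int[lambda]_(y in Omega) bform (D y) (grad (phi i) y) (grad (phi j) y) <= 0.
Proof.
move=> acute dtD dt0 ij; have [b [c phiE]] := P1_coefficients hphi.
rewrite (mass_entry d_gt0 hTh hphi phiE) (stiffness_entry d_gt0 oOmega hTh hphi phiE hD).
have dS : d.+1%:R = d%:R + 1 :> R by rewrite -[in LHS]addn1 natrD.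
have dSS : d.+2%:R = d%:R + 2 :> R by rewrite -addn2 natrD.
have den : 0 < d.+1%:R * d.+2%:R :> R by rewrite mulr_gt0.
rewrite mulr_sumr big_mkcondr -big_split/=; apply: sumr_le0 => K KTh.
case: ifPn => [/andP[iK jK]|]; last first.
  rewrite negb_and !(elt_gradE hTh hphi phiE)// => /orP[]kK;
    have [-> _] := coord_out hTh hphi phiE KTh kK.
    by rewrite /bform trmx0 !mul0mx mxE !mulr0 addr0.
  by rewrite /bform mulmx0 mxE !mulr0 addr0.
rewrite (negbTE ij) addr0 mulr1.
have := acute_elt KTh iK jK ij; set q := bform _ _ _ => Dq.
(* If [D_acute] is 0, the lower bound is [+oo] and no [dt] meets it. *)
move: dtD; rewrite /efrac; case: ifPn => [_|D0].
  by rewrite leye_eq.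
rewrite lee_fin -dS -dSS => dtD.
have D_gt0 : 0 < D_acute Omega x Th phi D.
  by rewrite lt_neqAle acute andbT eq_sym; apply: contraNneq D0 => ->; rewrite mulr0.
have s_ge0 : 0 <= mesh_scale Omega Th by exact: powR_ge0.
(* Read off from [0 < D_acute <= mesh_scale * - q]. *)
have s_gt0 : 0 < mesh_scale Omega Th.
  rewrite lt_neqAle s_ge0 andbT eq_sym; apply/eqP => s0.
  by have := lt_le_trans D_gt0 Dq; rewrite s0 mul0r ltxx.
(* Bounding [D_acute] by [mesh_scale * - q] in the time step condition lets the mesh scale
   cancel. *)
have q1 : 1 <= dt * (d.+1%:R * d.+2%:R) * - q.
  move: dtD; rewrite (ler_pdivrMr _ _ (mulr_gt0 den D_gt0)) => /le_trans h.
  rewrite -(ler_pM2l s_gt0) mulr1.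
  have {}h := h _ (ler_wpM2l (ltW dt0) (ler_wpM2l (ltW den) Dq)).
  apply: le_trans h _; rewrite le_eqVlt; apply/orP; left; apply/eqP; ring.
rewrite [X in _ + X](_ : _ = volume (hull x K) * (dt * q)); last by ring.
rewrite -mulrDr mulr_ge0_le0//; first exact/ltW/(volume_gt0 d_gt0 hTh hphi phiE).
rewrite -(pmulr_rle0 _ den) mulrDr divff ?lt0r_neq0//.
by move: q1; lra.
Qed.

End step.

Theorem theorem3p1 (R : realType) (d : nat) (hd : (1 <= d <= 3)%N)
  (Omega : set 'rV[R]_d) (hOmega : polyhedral_domain Omega)
  (D : 'rV[R]_d -> 'M[R]_d) (hD : diffusion_tensor Omega D)
  (f : R -> R) (hf : reaction_term f)
  (u0 : 'rV[R]_d -> R) (g : 'rV[R]_d -> R -> R) (T : R) (hT : 0 < T)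
  (Nv Nvi : nat) (x : 'I_Nv -> 'rV[R]_d) (Th : {set {set 'I_Nv}})
  (hTh : triangulation Omega x Th Nvi)
  (phi : 'I_Nv -> 'rV[R]_d -> R) (hphi : P1_basis Omega x Th phi)
  (N : nat) (t : nat -> R) (ht0 : t 0%N = 0)
  (ht : forall n, (n < N)%N -> t n < t n.+1) (htT : t N <= T)
  (u : nat -> 'cV[R]_Nv)
  (hu0 : forall y, closure Omega y -> 0 <= u0 y)
  (hg : forall y s, boundary Omega y -> 0 < s -> s <= T -> 0 <= g y s)
  (hinit : u 0%N = \col_j u0 (x j))
  (hscheme : forall n, (n < N)%N ->
     let dt := t n.+1 - t n in
     let M := mass_mx Omega phi Nvi in
     let A := stiffness_mx Omega phi D Nvi in
     let C := reaction_mx Omega phi Nvi f (u n) in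
     (M + dt *: A) *m u n.+1 =
     (M + dt *: C) *m u n + dt *: boundary_vec x Nvi g (t n.+1))
  (hacute : 0 <= D_acute Omega x Th phi D)
  (hdt : forall n, (n < N)%N ->
     let dt := t n.+1 - t n in
     (efrac (mesh_scale Omega Th)
            ((d%:R + 1) * (d%:R + 2) * D_acute Omega x Th phi D) <= dt%:E)%E /\
     (dt%:E <= efrac 1 (max_fneg Omega phi f (u n)))%E) :
  (forall n, (n <= N)%N -> forall j, 0 <= u n j 0) /\
  (forall n, (n <= N)%N -> forall y, Omega y -> 0 <= fe_fun phi (u n) y).
Proof.
have d_gt0 : (0 < d)%N by case/andP: hd.
have oOmega := domain_open hOmega.
have t_mono m : (m <= N)%N -> forall k, (k <= m)%N -> t k <= t m.
  elim: m => [|m IHm] mN k; first by rewrite leqn0 => /eqP->.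
  rewrite leq_eqVlt => /predU1P[->//|km].
  exact: le_trans (IHm (ltnW mN) k km) (ltW (ht _ mN)).
(* The boundary data are known to be nonnegative only at times in []0, T]]. *)
have t_gt0 n : (n < N)%N -> 0 < t n.+1 <= T.
  move=> nN; rewrite (le_trans (t_mono _ (leqnn N) _ nN) htT) andbT -ht0.
  exact: le_lt_trans (t_mono _ (ltnW nN) _ (leq0n n)) (ht _ nN).
have closure_vertex j : closure Omega (x j).
  rewrite (mesh_cover hTh); have [K KTh jK] := mesh_vertex hTh j.
  by exists K => //; exact: vertex_hull.
have u_ge0 n : (n <= N)%N -> forall j, 0 <= u n j 0.
  elim: n => [_ j|n IHn nN]; first by rewrite hinit mxE; exact: hu0.
  have {}IHn := IHn (ltnW nN).
  have dt0 : 0 < t n.+1 - t n by rewrite subr_gt0 ht.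
  have [dtD dtf] := hdt n nN; have sch := hscheme n nN.
  move: dt0 dtD dtf sch => /=; set dt := t n.+1 - t n => dt0 dtD dtf sch.
  have row i := congr1 (fun v : 'cV[R]_Nv => v i 0) sch.
  pose B := mass_mx Omega phi Nvi + dt *: stiffness_mx Omega phi D Nvi.
  have BE (i j : 'I_Nv) (iI : (i < Nvi)%N) : B i j =
      \int[lebesgue_rV R d]_(y in Omega) (phi j y * phi i y) +
      dt * \int[lebesgue_rV R d]_(y in Omega)
        bform (D y) (grad (phi i) y) (grad (phi j) y).
    by rewrite !mxE iI.
  apply: (@discrete_minimum_principle _ _ (fun i : 'I_Nv => (i < Nvi)%N) B).
  (* In a boundary row [M] and [C] vanish and [A] is the identity, so the scheme reduces to
     [dt * u_i = dt * g (x_i)] at the new time. *)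
  - move=> i iI; have := row i; rewrite !mxE.
    under eq_bigr do rewrite !mxE (negbTE iI) add0r.
    under [X in _ = X + _]eq_bigr do rewrite !mxE (negbTE iI) mulr0 addr0 mul0r.
    rewrite big1_eq add0r (negbTE iI) (bigD1 i)//= eqxx mulr1 big1 ?addr0; last first.
      by move=> j /negbTE; rewrite eq_sym => ->; rewrite mulr0 mul0r.
    move/(mulfI (lt0r_neq0 dt0)) ->; have /andP[? ?] := t_gt0 n nN; apply: hg => //.
    by apply: contrapT => /(mesh_numbering hTh); exact/negP.
  - move=> i j iI ij; rewrite BE//.
    exact: (mass_stiffness_le0 d_gt0 oOmega hTh hphi hD).
  - move=> i iI; under eq_bigr do rewrite BE//.
    rewrite big_split/= -mulr_sumr.
    have [b [c phiE]] := P1_coefficients hphi.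
    rewrite (stiffness_row_sum d_gt0 oOmega hTh hphi phiE hD) mulr0 addr0.
    exact: (mass_row_sum_gt0 d_gt0 hTh hphi phiE).
  (* In an interior row the boundary vector is 0, and [M + dt *: C] has nonnegative entries acting
     on the nonnegative [u n]. *)
  - move=> i iI; rewrite row mxE mxE addr_ge0//; last first.
      by rewrite !mxE iI mulr0.
    apply: sumr_ge0 => j _; apply: mulr_ge0 => //.
    rewrite !mxE iI; apply: (mass_reaction_ge0 d_gt0 hTh hphi hf) => //; exact: ltW.
split=> // n nN y Oy; apply: sumr_ge0 => j _; apply: mulr_ge0; first exact: u_ge0.
have [b [c phiE]] := P1_coefficients hphi.
by have /andP[] := P1_01 hTh hphi phiE j (subset_closure Oy).
Qed.
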